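(* Let $I\subseteq\Bbbk[x_i,x_j,x_k]$ be a monomial ideal and let $\mathbf b\in\mathbb N^3$ be such that $K^{\mathbf b}I$ is the complex with facets the edge $\{i,j\}$ and the isolated vertex $k$. Let $\mathbf a_1,\dots,\mathbf a_s$ be the degree vectors of the minimal generators of $I$ that lie behind $\mathbf b$ in the direction of the edge $\{i,j\}$, ordered so that the $j$-th component is strictly increasing. Put $$m=\max\{\,|\mathbf b-\mathbf b_\lambda| : 1\le \ell\le s,\ \lambda\in\Lambda(\mathbf a_\ell,\mathbf b)\,\}.$$ Consider the $2^m$ lattice paths that start at $\mathbf b$ and take $m$ steps, each step being $-\mathbf e_i$ or $-\mathbf e_j$ (equivalently, the decreasing lattice paths in an $m\times m$ grid from the bottom right corner $\mathbf b$ to the diagonal joining the bottom left and top right corners). Then for every $\ell$, $$D^{\mathbf a_\ell\mathbf b}_{\varnothing i}=\frac{N_\ell}{2^m},$$ where $N_\ell$ is the number of these paths that either pass between the neighboring syzygies of $\mathbf a_\ell$, or pass through a neighboring syzygy of $\mathbf a_\ell$ and leave it in the direction of $\mathbf a_\ell$.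
   Context: Throughout $\Bbbk$ is a field with $\operatorname{char}(\Bbbk)\neq 2,3$; $\{i,j,k\}$ is the set of the three variable indices in an arbitrary labelling; $\mathbf e_i,\mathbf e_j,\mathbf e_k$ are the standard basis vectors of $\mathbb N^3$; $\preceq$ is the componentwise order, and $|\mathbf c|$ is the sum of the coordinates of $\mathbf c$. Koszul complex: $K^{\mathbf b}I=\{\tau\subseteq\{i,j,k\}: \mathbf x^{\mathbf b-\tau}\in I\}$, where $\tau$ is identified with its $0/1$ indicator vector (a monomial with a negative exponent is not in $I$). A degree $\mathbf a$ lies behind $\mathbf b$ in the direction of the edge $\{i,j\}$ if $\mathbf a\preceq\mathbf b$ and $\operatorname{supp}(\mathbf b-\mathbf a)\subseteq\{i,j\}$. For a lattice path $\lambda$ from $\mathbf b$, $\mathbf b_\lambda$ is the degree vector on $\lambda$ closest to $\mathbf b$ such that $K^{\mathbf b_\lambda}I$ contains one or fewer vertices. Neighboring syzygies: the neighboring syzygies of $\mathbf a_\ell$ are the degree vectors $\sigma^-=\operatorname{lcm}(\mathbf a_\ell,\mathbf a_{\ell-1})$ and $\sigma^+=\operatorname{lcm}(\mathbf a_\ell,\mathbf a_{\ell+1})$ (componentwise maxima), whenever the index $\ell-1$, respectively $\ell+1$, lies in $\{1,\dots,s\}$. The direction of $\mathbf a_\ell$ from $\sigma^+$ is $-\mathbf e_j$, and from $\sigma^-$ it is $-\mathbf e_i$. Each path of $m$ steps from $\mathbf b$ has exactly one point $\mathbf c$ with $|\mathbf b-\mathbf c|=|\mathbf b-\sigma|$ for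 $\sigma=\sigma^{\pm}$; the path passes $\sigma^+$ on the $\mathbf a_\ell$-side if this $\mathbf c$ satisfies $c_j<\sigma^+_j$, and passes $\sigma^-$ on the $\mathbf a_\ell$-side if $c_i<\sigma^-_i$. A path is counted by $N_\ell$ exactly when, for each existing neighboring syzygy $\sigma$ of $\mathbf a_\ell$, it either passes $\sigma$ on the $\mathbf a_\ell$-side, or passes through $\sigma$ and its next step is in the direction of $\mathbf a_\ell$ from $\sigma$. Fix a total order on the vertices to orient faces. For a simplicial complex $K$, $K_d$ is the set of $d$-faces, $\widetilde C_d$ and $\widetilde B_d$ the reduced chains and boundaries over $\Bbbk$, $\partial$ the reduced boundary map (so $\partial v=\varnothing$). A shrubbery in dimension $d$ is $T_d\subseteq K_d$ whose boundaries $\partial\tau$, $\tau\in T_d$, form a basis of $\widetilde B_{d-1}(K)$. A stake set in dimension $d$ is $S_d\subseteq K_d$ whose complement $K_d\setminus S_d$ gives a basis of $\widetilde C_d(K)/\widetilde B_d(K)$. A hedge of dimension $d$ is a pair $ST_d=(S_{d-1},T_d)$. The circuit of a $d$-face $\tau$ is the unique cycle $\zeta_{T_d}(\tau)=\tau-t$ with $t\in\Bbbk\{T_d\}$; $\tau$ is cycle-linked to $\tau'$ if $\tau'$ has nonzero coefficient in it. The shrub of a stake $\sigma\in S_{d-1}$ is the unique chain $s(\sigma)\in\Bbbk\{T_d\}$ whose boundary has coefficient $1$ on $\sigma$ and $0$ on all other stakes in $S_{d-1}$; $\sigma$ is chain-linked to $\tau'$ if $\tau'$ has nonzero coefficient in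 $s(\sigma)$. The hedge rim of a $d$-face $\tau$ is the unique chain $r(\tau)\in\Bbbk\{K_d\setminus S_d\}$ with $\tau-r(\tau)$ a boundary; $\tau$ is boundary-linked to $\tau'$ if $\tau'$ has nonzero coefficient in $r(\tau)$. $\Lambda(\mathbf a,\mathbf b)$ is the set of saturated decreasing lattice paths $\lambda=(\mathbf a=\mathbf b_n,\mathbf b_{n-1},\dots,\mathbf b_1,\mathbf b_0=\mathbf b)$, i.e. $\mathbf b_{\ell-1}-\mathbf b_\ell$ is a standard basis vector $\mathbf e_{k_\ell}$ for each $\ell$. A hedgerow in dimension $d$ on $\lambda$ consists of a stake set $S_d^{\mathbf b}$ in $K^{\mathbf b}I$, a hedge of dimension $d$ in $K^{\mathbf b_\ell}I$ for $\ell=1,\dots,n-1$, and a shrubbery $T_{d-1}^{\mathbf a}$ in $K^{\mathbf a}I$. A chain-link fence along $\lambda$ from a $d$-face $\tau$ of $K^{\mathbf b}I$ to a $(d-1)$-face $\sigma$ of $K^{\mathbf a}I$ consists of a hedgerow and faces $\tau_0,\sigma_1,\tau_1,\dots,\sigma_{n-1},\tau_{n-1},\sigma_n$, with $\tau_\ell\in K_d^{\mathbf b_\ell}I$ and $\sigma_\ell\in K_{d-1}^{\mathbf b_\ell}I$, such that $\tau$ is boundary-linked to $\tau_0$; $\sigma_\ell=\tau_{\ell-1}\setminus\{k_\ell\}$ (with $k_\ell\in\tau_{\ell-1}$) for $\ell=1,\dots,n$; $\sigma_\ell$ is a stake in $S_{d-1}^{\mathbf b_\ell}$ chain-linked to $\tau_\ell$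 for $1\le\ell\le n-1$; and $\sigma_n$ is cycle-linked to $\sigma$. Its weight $w_\phi$ is the product of: the coefficient of $\tau_0$ in the hedge rim of $\tau$; the coefficients of $\tau_\ell$ in the shrub of $\sigma_\ell$; the coefficients of $\sigma_\ell$ in $\partial\tau_{\ell-1}$; and the coefficient of $\sigma$ in the circuit of $\sigma_n$. (In three variables the extra determinant factors in the general weights are all $1$.) The sylvan matrix entry, for a $d$-face $\tau\in K^{\mathbf b}I$ and a $(d-1)$-face $\sigma\in K^{\mathbf a}I$, is $$D^{\mathbf a\mathbf b}_{\sigma\tau}=\sum_{\lambda\in\Lambda(\mathbf a,\mathbf b)}\frac1{\Delta_{d,\lambda}I}\sum_{\phi}w_\phi,$$ where $\Delta_{d,\lambda}I$ is the number of hedgerows of dimension $d$ on $\lambda$ and $\phi$ runs over the chain-link fences from $\tau$ to $\sigma$ along $\lambda$. Here $d=0$. *)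

(* Defs.v *)
From mathcomp Require Import all_boot all_order all_algebra.
From mathcomp Require Export mpoly.
From Stdlib Require Import ClassicalEpsilon.

Set Implicit Arguments.
Unset Strict Implicit.
Unset Printing Implicit Defensive.

Import GRing.Theory.
Local Open Scope ring_scope.

(* Dimensions are shifted by one, so that the empty face (dimension -1) can be
   indexed by nat: below, c is the number of vertices of a face, and objects
   "of size c" are objects of dimension c - 1. *)
Section Hedges.

Variables (F : fieldType) (V : finType) (leT : rel V).

Implicit Types (K S T : {set {set V}}) (t u : {set V}) (c : nat).

Definition chain := {ffun {set V} -> F^o}.

Definition face_chain t : chain := [ffun u => (u == t)%:R].

Definition face_span T : {vspace chain} :=
  <<[seq face_chain t | t <- enum T]>>%VS.

Definition face_boundary t : chain :=
  \sum_(v in t)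
    (-1) ^+ #|[set w in t | leT w v & w != v]| *: face_chain (t :\ v).

Definition boundary (z : chain) : chain := \sum_t z t *: face_boundary t.

Definition faces c K : {set {set V}} := [set t in K | #|t| == c].

Definition facets K : {set {set V}} := [set t | maxset (fun u => u \in K) t].

(* Image of the chains of size c under the boundary map: the reduced
   boundaries of dimension c - 2. *)
Definition boundaries_of c K : {vspace chain} :=
  <<[seq face_boundary t | t <- enum (faces c K)]>>%VS.

Definition is_shrubbery c K T : bool :=
  (T \subset faces c K) &&
  basis_of (boundaries_of c K) [seq face_boundary t | t <- enum T].

(* The classes of the faces outside S form a basis of chains modulo
   boundaries: they generate modulo boundaries, and no nonzero combination of
   them (the faces being linearly independent chains) is a boundary. *)
Definition is_stake_set c K S : bool :=
  [&& S \subset faces c K,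
      (face_span (faces c K :\: S) + boundaries_of c.+1 K ==
         face_span (faces c K))%VS
    & (face_span (faces c K :\: S) :&: boundaries_of c.+1 K == 0)%VS].

(* A hedge (S, T) whose shrubbery T has size c.+1. *)
Definition is_hedge c K (h : {set {set V}} * {set {set V}}) : bool :=
  is_stake_set c K h.1 && is_shrubbery c.+1 K h.2.

(* The next three chains exist and are unique when S, T are (parts of) hedges;
   epsilon returns them. *)
Definition circuit T t : chain :=
  epsilon (inhabits 0) (fun z : chain =>
    boundary z = 0 /\
    exists2 y : chain, y \in face_span T & z = face_chain t - y).

Definition shrub S T u : chain :=
  epsilon (inhabits 0) (fun z : chain =>
    [/\ z \in face_span T, boundary z u = 1
      & forall u', u' \in S -> u' != u -> boundary z u' = 0]).

Definition hedge_rim c K S t : chain :=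
  epsilon (inhabits 0) (fun z : chain =>
    z \in face_span (faces c K :\: S) /\
    face_chain t - z \in boundaries_of c.+1 K).

End Hedges.

Section MonomialIdeals.

Variable F : fieldType.

Implicit Types (I : {pred {mpoly F[3]}}) (a b u : 'X_{1..3}).

(* I is the ideal generated by the monomials with exponents in G. *)
Definition monomial_ideal I : Prop :=
  exists G : 'X_{1..3} -> Prop, forall p : {mpoly F[3]},
    p \in I <->
    exists s : seq ({mpoly F[3]} * 'X_{1..3}),
      (forall x, x \in s -> G x.2) /\ p = \sum_(x <- s) x.1 * 'X_[x.2].

Definition min_generator I u : Prop :=
  'X_[u] \in I /\ forall u', (u' <= u)%MM -> 'X_[u'] \in I -> u' = u.

Definition indicator (t : {set 'I_3}) : 'X_{1..3} :=
  [multinom nat_of_bool (v \in t) | v < 3].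

(* Subtraction on exponents is truncated, hence the guard. *)
Definition koszul I b : {set {set 'I_3}} :=
  [set t | (indicator t <= b)%MM && ('X_[(b - indicator t)%MM] \in I)].

Definition lies_behind (i j : 'I_3) a b : Prop :=
  (a <= b)%MM /\ forall v, (b - a)%MM v != 0%N -> v \in [:: i; j].

End MonomialIdeals.

(* A path descending from b is encoded by the word w = k_1 ... k_n of the
   directions of its steps; path_degree b w l is b_l. *)
Section LatticePaths.

Implicit Types (a b : 'X_{1..3}) (w : seq 'I_3) (l : nat).

Definition word_degree w : 'X_{1..3} := [multinom count_mem v w | v < 3].

Definition path_degree b w l : 'X_{1..3} := (b - word_degree (take l w))%MM.

Definition is_path a b w : bool := (a + word_degree w)%MM == b.

End LatticePaths.

Section Sylvan.

Variables (F : fieldType) (leT : rel 'I_3) (I : {pred {mpoly F[3]}}).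

Local Notation face := {set 'I_3}.

(* (S_d^b, hedges in K^{b_1} I, ..., K^{b_{n-1}} I, T_{d-1}^a) *)
Definition hedgerow (n : nat) : Type :=
  ({set face} * n.-1.-tuple ({set face} * {set face}) * {set face})%type.

Definition hedge_at n (H : hedgerow n) (l : nat) : {set face} * {set face} :=
  nth (set0, set0) H.1.2 l.-1.

(* d is the dimension, with d-faces of size d.+1. *)
Definition is_hedgerow (d : nat) a b n (w : n.-tuple 'I_3) (H : hedgerow n) :
    bool :=
  [&& is_stake_set F leT d.+1 (koszul I b) H.1.1,
      [forall l : 'I_n.-1,
         is_hedge F leT d (koszul I (path_degree b w l.+1)) (hedge_at H l.+1)]
    & is_shrubbery F leT d (koszul I a) H.2].

Definition nb_hedgerows d a b n (w : n.-tuple 'I_3) : nat :=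
  #|[set H : hedgerow n | is_hedgerow d a b w H]|.

(* taus = (tau_0, ..., tau_{n-1}) and sigs = (sigma_1, ..., sigma_n), so that
   k_l and sigma_l have position l.-1 in w and sigs. *)
Definition is_fence (d : nat) a b (tau sigma : face) n (w : n.-tuple 'I_3)
    (H : hedgerow n) (taus sigs : n.-tuple face) : bool :=
  let tau_ l := nth set0 taus l in
  let sig_ l := nth set0 sigs l.-1 in
  let k_ l := nth ord0 w l.-1 in
  [&& is_hedgerow d a b w H,
      [forall l : 'I_n,
         tau_ l \in faces d.+1 (koszul I (path_degree b w l))],
      [forall l : 'I_n,
         sig_ l.+1 \in faces d (koszul I (path_degree b w l.+1))],
      hedge_rim F leT d.+1 (koszul I b) H.1.1 tau (tau_ 0%N) != 0,
      [forall l : 'I_n,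
         (k_ l.+1 \in tau_ l) && (sig_ l.+1 == tau_ l :\ k_ l.+1)],
      [forall l : 'I_n.-1,
         (sig_ l.+1 \in (hedge_at H l.+1).1) &&
         (shrub F leT (hedge_at H l.+1).1 (hedge_at H l.+1).2
            (sig_ l.+1) (tau_ l.+1) != 0)]
    & circuit F leT H.2 (sig_ n) sigma != 0].

Definition fence_weight (d : nat) b (tau sigma : face) n
    (H : hedgerow n) (taus sigs : n.-tuple face) : F :=
  let tau_ l := nth set0 taus l in
  let sig_ l := nth set0 sigs l.-1 in
  hedge_rim F leT d.+1 (koszul I b) H.1.1 tau (tau_ 0%N) *
  (\prod_(1 <= l < n)
     shrub F leT (hedge_at H l).1 (hedge_at H l).2 (sig_ l) (tau_ l)) *
  (\prod_(1 <= l < n.+1) face_boundary F leT (tau_ l.-1) (sig_ l)) *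
  circuit F leT H.2 (sig_ n) sigma.

(* The entry D^{ab}_{sigma tau}. *)
Definition sylvan_entry (d : nat) a b (sigma tau : face) : F :=
  let n := mdeg (b - a)%MM in
  \sum_(w : n.-tuple 'I_3 | is_path a b w)
    (nb_hedgerows d a b w)%:R^-1 *
    \sum_(H : hedgerow n) \sum_(taus : n.-tuple face)
      \sum_(sigs : n.-tuple face | is_fence d a b tau sigma w H taus sigs)
        fence_weight d b tau sigma H taus sigs.

(* b_lambda *)
Definition path_stop b (w : seq 'I_3) : 'X_{1..3} :=
  path_degree b w
    (find (fun l => (#|faces 1 (koszul I (path_degree b w l))| <= 1)%N)
          (iota 0 (size w).+1)).

Definition grid_size (gens : seq 'X_{1..3}) b : nat :=
  \max_(a <- gens)
    \max_(w : (mdeg (b - a)%MM).-tuple 'I_3 | is_path a b w)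
      mdeg (b - path_stop b w)%MM.

End Sylvan.

(* Grid paths may leave N^3, so their points have integer coordinates. *)
Section GridPaths.

Implicit Types (b sg : 'X_{1..3}) (w : seq 'I_3) (v : 'I_3).

Definition grid_point b w (r : nat) v : int :=
  (b v)%:Z - (count_mem v (take r w))%:Z.

(* The point c with |b - c| = |b - sg| is reached after |b - sg| steps, and
   the direction of the generator from the syzygy sg is - e_v. *)
Definition takes_side b sg v w : bool :=
  let r := mdeg (b - sg)%MM in
  (grid_point b w r v < (sg v)%:Z) ||
  [forall v', grid_point b w r v' == (sg v')%:Z] && (onth w r == Some v).

(* N_l, with the generators a_1, ..., a_s numbered from 0 in gens. *)
Definition nb_grid_paths (gens : seq 'X_{1..3}) b (i j : 'I_3) (m l : nat) :
    nat :=
  let a_ l := nth 0%MM gens l in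
  #|[set w : m.-tuple 'I_3 |
     [&& all (fun v => v \in [:: i; j]) w,
         (0 < l)%N ==> takes_side b (mlcm (a_ l) (a_ l.-1)) i w
       & (l.+1 < size gens)%N ==>
           takes_side b (mlcm (a_ l) (a_ l.+1)) j w]]|.

End GridPaths.

(* Main.v *)
(* In the plane of degrees b - x e_i - y e_j, a degree lies in I exactly when
   some a_p lies below it, i.e. x <= al p and y <= be p with al increasing and
   be decreasing, and away from b the vertex k never belongs to the Koszul
   complex, because K^b I has no edge containing k.  On a path lambda from b to
   a_l every hedge is a choice of one vertex, and the only fence uses the vertex
   in the direction of each step and has weight 1; the number of hedgerows is
   2^r, where r = |b - b_lambda|, since there are two choices up to b_lambda and
   one afterwards.  Hence D is the sum of 2^-r over the paths to a_l.  A path is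
   forced after b_lambda, so 2^(m - r) counts the words of length m that agree
   with it on its first r letters, and D 2^m is the number of words whose first
   degree with fewer than two vertices leads to a_l.  Those are exactly the
   words that pass every neighboring syzygy of a_l on its side. *)
Require Import Defs.
From mathcomp Require Import all_boot all_order all_algebra.
From mathcomp Require Import mpoly.
From mathcomp Require Import zify.
From Stdlib Require Import Classical ClassicalEpsilon.

Set Implicit Arguments.
Unset Strict Implicit.
Unset Printing Implicit Defensive.

Import GRing.Theory.
Local Open Scope ring_scope.

(** * Hedges of complexes of dimension at most one *)

Section Chains.

Variables (F : fieldType) (V : finType) (leT : rel V).
Implicit Types (K S T : {set {set V}}) (t u : {set V}) (z : chain F V).

Lemma face_chainE t u : face_chain F t u = (u == t)%:R.
Proof. by rewrite /face_chain ffunE. Qed.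

Lemma chainZE (c : F) z u : (c *: z) u = c * z u.
Proof. by rewrite ffunE. Qed.

Lemma chain_sumE (J : Type) (r : seq J) (P : pred J) (f : J -> chain F V) u :
  (\sum_(p <- r | P p) f p) u = \sum_(p <- r | P p) f p u :> F.
Proof. by rewrite sum_ffunE. Qed.

Lemma chain_sum z : z = \sum_t z t *: face_chain F t.
Proof.
apply/ffunP=> u; rewrite chain_sumE (bigD1 u) //= big1 => [|t tu].
  by rewrite chainZE face_chainE eqxx mulr1 addr0.
by rewrite chainZE face_chainE eq_sym (negPf tu) mulr0.
Qed.

(** The chains [face_chain F t] form the standard basis, so membership in such a span can be tested
    coefficient by coefficient; stake sets and hedge rims are handled through this test. *)
Lemma mem_face_span T z :
  (z \in face_span F T) = [forall u, (u \notin T) ==> (z u == 0)].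
Proof.
apply/idP/forall_inP=> [zT u uT | zT].
  rewrite (coord_span zT) chain_sumE big1 // => p _.
  rewrite chainZE (_ : _ u = 0) ?mulr0 //.
  have ps : (p < size (enum T))%N by rewrite -cardE ltn_ord.
  rewrite (nth_map set0) // face_chainE; case: eqP => // ut.
  by rewrite ut -mem_enum mem_nth in uT.
rewrite (chain_sum z) memv_suml // => u _.
have [uT | /zT/eqP->] := boolP (u \in T); last by rewrite scale0r mem0v.
by rewrite memvZ // memv_span // map_f // mem_enum.
Qed.

Lemma face_chain_neq0 t : face_chain F t != 0.
Proof.
apply/eqP=> /ffunP/(_ t); rewrite face_chainE ffunE eqxx; exact/eqP/oner_neq0.
Qed.

Lemma face_span0 : face_span F (set0 : {set {set V}}) = 0%VS.
Proof. by rewrite /face_span enum_set0 span_nil. Qed.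

Lemma face_span1 t : face_span F [set t] = <[face_chain F t]>%VS.
Proof. by rewrite /face_span enum_set1 span_seq1. Qed.

Lemma face_boundary0 : face_boundary F leT set0 = 0.
Proof. by rewrite /face_boundary big_set0. Qed.

Lemma face_boundary1 v : face_boundary F leT [set v] = face_chain F set0.
Proof.
rewrite /face_boundary big_set1 (_ : [set w in [set v] | _] = set0).
  by rewrite cards0 expr0 scale1r setDv.
by apply/setP=> w; rewrite !inE; case: eqP => //= ->; rewrite andbF.
Qed.

(** The sign depends on which endpoint comes first in [leT]. Only the line spanned by the boundary
    matters later, so a nonzero scalar [e] is enough. *)
Lemma face_boundary2 i j : total leT -> antisymmetric leT -> i != j ->
  exists2 e : F, e != 0 &
    face_boundary F leT [set i; j] =
      e *: (face_chain F [set i] - face_chain F [set j]).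
Proof.
move=> tot anti ij; exists ((-1) ^+ leT i j); first by rewrite signr_eq0.
rewrite /face_boundary big_setU1 ?inE //= big_set1 addrC.
have cardE x y : x != y -> [set w in [set x; y] | leT w x & w != x] =
    if leT y x then [set y] else set0.
  move=> xy; apply/setP=> w; case: ifP => yx; rewrite !inE.
    have [->|wx] := eqVneq w x; first by rewrite (negPf xy) andbF.
    by have [->|] := eqVneq w y; rewrite ?yx.
  have [->|wx] := eqVneq w x; first by rewrite andbF.
  by have [->|] := eqVneq w y; rewrite ?yx.
have -> : [set i; j] :\ i = [set j].
  by apply/setP=> w; rewrite !inE; case: (eqVneq w i) => // ->; rewrite (negPf ij).
have -> : [set i; j] :\ j = [set i].
  apply/setP=> w; rewrite !inE; case: (eqVneq w j) => [->|_]; rewrite ?orbF //.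
  by rewrite eq_sym (negPf ij).
rewrite (cardE i) // [X in _ + _ = X]scalerBr.
rewrite [in X in X + _](setUC [set i]) (cardE j) 1?eq_sym //.
have := tot i j; have := anti i j; case: (leT i j); case: (leT j i) => //=.
  by move=> /(_ isT) e; rewrite e eqxx in ij.
all: by rewrite cards0 cards1 expr0 expr1 !scale1r !scaleN1r ?opprK.
Qed.

Lemma boundary_face_chain t : boundary leT (face_chain F t) = face_boundary F leT t.
Proof.
rewrite /boundary (bigD1 t) //= big1 => [|u ut]; rewrite face_chainE.
  by rewrite eqxx scale1r addr0.
by rewrite (negPf ut) scale0r.
Qed.

Lemma boundaryZ c z : boundary leT (c *: z) = c *: boundary leT z.
Proof.
by rewrite /boundary scaler_sumr; apply: eq_bigr => t _; rewrite ffunE scalerA.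
Qed.

Lemma sub_faces_set0 K T : T \subset faces 0 K -> T = set0 \/ T = [set set0].
Proof.
move=> sT; have : T \subset [set set0].
  by apply: subset_trans sT _; apply/subsetP=> t; rewrite !inE cards_eq0 => /andP[].
by rewrite subset1 => /orP[/eqP|/eqP]; [right | left].
Qed.

(** The empty face has zero boundary, so it cannot belong to a basis. The shrubbery at the end of a
    path is therefore forced. *)
Lemma is_shrubbery_size0 K T : is_shrubbery F leT 0 K T = (T == set0).
Proof.
have b0 : boundaries_of F leT 0 K = 0%VS.
  apply/eqP; rewrite -subv0; apply/span_subvP=> z /mapP[t].
  rewrite mem_enum inE cards_eq0 => /andP[_ /eqP->] ->.
  by rewrite face_boundary0 mem0v.
apply/andP/eqP=> [[/sub_faces_set0[]-> //]|->].
  by rewrite enum_set1 /= face_boundary0 /basis_of free_cons mem0v andbF.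
by rewrite sub0set b0 enum_set0 /= nil_basis.
Qed.

Lemma faces0 K : set0 \in K -> faces 0 K = [set set0].
Proof.
move=> K0; apply/setP=> t; rewrite !inE cards_eq0 andbC.
by case: eqP => // ->.
Qed.

Lemma set1_faces K v : [set v] \in K -> [set v] \in faces 1 K.
Proof. by rewrite inE cards1 eqxx andbT. Qed.

Lemma boundary_size1 K t : t \in faces 1 K ->
  face_boundary F leT t = face_chain F set0.
Proof. by rewrite inE => /andP[_ /cards1P[v ->]]; apply: face_boundary1. Qed.

Lemma boundaries_of_size1 K v : [set v] \in K ->
  boundaries_of F leT 1 K = <[face_chain F set0]>%VS.
Proof.
move=> Kv; apply/eqP; rewrite eqEsubv; apply/andP; split.
  apply/span_subvP=> z /mapP[t]; rewrite mem_enum => /boundary_size1-> ->.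
  exact: memv_line.
rewrite -memvE memv_span //; apply/mapP; exists [set v].
  by rewrite mem_enum inE Kv cards1 eqxx.
by rewrite face_boundary1.
Qed.

(** All vertices have the same nonzero boundary, the empty face, so the boundaries form a line. *)
Lemma is_shrubbery_size1 K v T : [set v] \in K ->
  is_shrubbery F leT 1 K T = (T \subset faces 1 K) && (#|T| == 1%N).
Proof.
move=> Kv; rewrite /is_shrubbery (boundaries_of_size1 Kv).
case: (boolP (T \subset _)) => //= sT; apply/idP/idP=> [bT|/cards1P[t Tt]].
  have := @vector.size_basis _ _ _ _ (in_tuple _) bT.
  by rewrite dim_vline face_chain_neq0 size_map -cardE => <-.
rewrite Tt enum_set1 /= (@boundary_size1 K t); last first.
  by rewrite (subsetP sT) // Tt inE.
exact/seq1_basis/face_chain_neq0.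
Qed.

(** The vertex [v] makes the empty face a boundary, so the quotient vanishes and no face may stay
    outside [S]. *)
Lemma is_stake_set_size0 K v S : set0 \in K -> [set v] \in K ->
  is_stake_set F leT 0 K S = (S == [set set0]).
Proof.
move=> K0 Kv; rewrite /is_stake_set (boundaries_of_size1 Kv) faces0 //.
apply/and3P/eqP=> [[+ _]|->].
  rewrite subset1 => /orP[/eqP // | /eqP->].
  by rewrite setD0 face_span1 capvv -dimv_eq0 dim_vline face_chain_neq0.
by rewrite setDv face_span0 face_span1 add0v cap0v !eqxx subxx.
Qed.

(** * Stake sets and hedge rims of a complex with exactly one edge *)

Section EdgeAndVertex.

Variables (K : {set {set V}}) (i j : V).
Hypotheses (tot : total leT) (anti : antisymmetric leT) (ij : i != j).
Hypotheses (Ki : [set i] \in K) (Kj : [set j] \in K).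
Hypothesis (K2 : faces 2 K = [set [set i; j]]).

Lemma boundaries_of_edge : boundaries_of F leT 2 K =
  <[face_chain F [set i] - face_chain F [set j]]>%VS.
Proof.
rewrite /boundaries_of K2 enum_set1 /= span_seq1.
have [e e0 ->] := face_boundary2 tot anti ij.
apply/eqP; rewrite eqEsubv -!memvE memvZ ?memv_line //=.
by rewrite -[X in X \in _]scale1r -(mulVf e0) -scalerA memvZ ?memv_line.
Qed.

Let d := face_chain F [set i] - face_chain F [set j].

Let dE u : d u = (u == [set i])%:R - (u == [set j])%:R.
Proof. by rewrite !ffunE. Qed.

Let set1_neq : ([set i] == [set j]) = false.
Proof. by rewrite (inj_eq set1_inj) (negPf ij). Qed.

Lemma stake_set_edge : is_stake_set F leT 1 K [set [set i]].
Proof.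
have d_in : d \in face_span F (faces 1 K).
  rewrite mem_face_span; apply/forall_inP=> u uK; rewrite dE.
  have [ui|_] := eqVneq u [set i]; first by rewrite ui set1_faces in uK.
  have [uj|_] := eqVneq u [set j]; first by rewrite uj set1_faces in uK.
  by rewrite subrr.
rewrite /is_stake_set sub1set set1_faces //= boundaries_of_edge.
apply/andP; split; last first.
  rewrite -subv0; apply/subvP=> z /memv_capP[+ /vlineP[c zc]].
  rewrite mem_face_span => /forall_inP/(_ [set i]).
  rewrite !inE eqxx => /(_ isT); rewrite zc chainZE -/d dE eqxx set1_neq.
  by rewrite subr0 mulr1 => /eqP->; rewrite scale0r mem0v.
rewrite eqEsubv subv_add -memvE d_in andbT; apply/andP; split.
  apply/subvP=> z; rewrite !mem_face_span => /forall_inP zF.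
  by apply/forall_inP=> u uK; apply: zF; rewrite inE negb_and uK orbT.
(* Since [d] has coefficient 1 on [i], subtracting [z [set i] *: d] removes the coefficient of [z]
   on the stake. *)
apply/subvP=> z zF; rewrite -[z](subrK (z [set i] *: d)).
rewrite memv_add ?memvZ ?memv_line //.
have zd_in : (z [set i] : F) *: d \in face_span F (faces 1 K) by rewrite memvZ.
have := rpredB zF zd_in; rewrite !mem_face_span => zF'.
apply/forall_inP=> u; rewrite inE negb_and negbK inE => /orP[/eqP->|].
  rewrite ffunE [X in _ + X]ffunE chainZE dE eqxx set1_neq.
  by rewrite subr0 mulr1 subrr.
exact: (forall_inP zF').
Qed.

(** The vertex [i] avoids the stake [j] and so is its own rim. Uniqueness comes from the coefficient
    on [j], which shows that a multiple of [d] separating two candidates is zero. *)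
Lemma hedge_rim_edge :
  hedge_rim F leT 1 K [set [set j]] [set i] = face_chain F [set i].
Proof.
rewrite /hedge_rim boundaries_of_edge; set P := (X in epsilon _ X).
have [|] := epsilon_spec (inhabits 0) P.
  exists (face_chain F [set i]); rewrite /P subrr mem0v mem_face_span; split=> //.
  apply/forall_inP=> u; rewrite !inE face_chainE negb_and negbK.
  case: (eqVneq u [set i]) => // ->.
  by rewrite set1_neq cards1 Ki.
rewrite mem_face_span => /forall_inP/(_ [set j]); rewrite !inE eqxx => /(_ isT).
move=> /eqP zj /vlineP[c ec]; move: (ec) => /(congr1 (fun z : chain F V => z [set j])).
rewrite ffunE [X in _ + X]ffunE zj chainZE -/d dE face_chainE eqxx eq_sym set1_neq.
rewrite !sub0r mulrN1 oppr0 => /esym/eqP; rewrite oppr_eq0 => /eqP c0.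
by move: ec; rewrite c0 scale0r => /eqP; rewrite subr_eq0 => /eqP.
Qed.

(** A rim avoids the stake [i], so the coefficient on [i] forces the boundary to be [d] itself,
    which trades [i] for [j]. *)
Lemma hedge_rim_edge' :
  hedge_rim F leT 1 K [set [set i]] [set i] = face_chain F [set j].
Proof.
rewrite /hedge_rim boundaries_of_edge; set P := (X in epsilon _ X).
have [|] := epsilon_spec (inhabits 0) P.
  exists (face_chain F [set j]); rewrite /P memv_line mem_face_span; split=> //.
  apply/forall_inP=> u; rewrite !inE face_chainE negb_and negbK.
  case: (eqVneq u [set j]) => // ->.
  by rewrite eq_sym set1_neq cards1 Kj.
rewrite mem_face_span => /forall_inP/(_ [set i]); rewrite !inE eqxx => /(_ isT).
move=> /eqP zi /vlineP[c ec]; move: (ec) => /(congr1 (fun z : chain F V => z [set i])).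
rewrite ffunE [X in _ + X]ffunE zi chainZE -/d dE face_chainE eqxx set1_neq.
rewrite !subr0 mulr1 => /esym c1.
by move: ec; rewrite c1 scale1r => /addrI/oppr_inj.
Qed.

End EdgeAndVertex.

Lemma is_stake_set_edge K i j S : total leT -> antisymmetric leT -> i != j ->
    [set i] \in K -> [set j] \in K -> faces 2 K = [set [set i; j]] ->
  is_stake_set F leT 1 K S = (S \in [set [set [set i]]; [set [set j]]]).
Proof.
move=> tot anti ij Ki Kj K2; rewrite !inE; apply/idP/orP; last first.
  case=> /eqP->; first exact: stake_set_edge K2.
  by apply: (@stake_set_edge K j i) => //; rewrite 1?eq_sym // setUC.
have ji : ([set j] == [set i]) = false.
  by rewrite (inj_eq set1_inj) eq_sym (negPf ij).
case/and3P=> sS /eqP sum; rewrite (boundaries_of_edge tot anti ij K2) in sum *.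
move=> /eqP cap0; set d := (_ - _) in sum cap0.
have dE u : d u = (u == [set i])%:R - (u == [set j])%:R by rewrite !ffunE.
(* Write [t] as a combination of non-stakes plus [c *: d] and read off the coefficients on [S]:
   there only the multiple of [d] survives. *)
have stakeE t : t \in S ->
    exists c : F, forall u, u \in S -> (u == t)%:R = c * d u.
  move=> tS; have : face_chain F t \in face_span F (faces 1 K).
    rewrite mem_face_span; apply/forall_inP=> u uK; rewrite face_chainE.
    case: (eqVneq u t) uK => [->|_ _]; first by rewrite (subsetP sS).
    by rewrite mulr0n eqxx.
  rewrite -sum => /memv_addP[y yS [_ /vlineP[c ->] e]]; exists c => u uS.
  rewrite -face_chainE e ffunE chainZE; move: yS; rewrite mem_face_span.
  by move=> /forall_inP/(_ u)/implyP; rewrite inE uS => /eqP->; rewrite add0r.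
have S_sub t : t \in S -> (t == [set i]) || (t == [set j]).
  move=> tS; have [c /(_ t tS)/eqP] := stakeE t tS; rewrite dE eqxx.
  by case: (t == [set i]) => //; case: (t == _) => //; rewrite subrr mulr0 oner_eq0.
(* On [S] the indicator of [i] would be [c * d], giving [c = 1] at [i] and [c = 0] at [j]. *)
have not_both : ([set i] \in S) && ([set j] \in S) = false.
  apply/andP=> -[iS jS]; have [c ec] := stakeE _ iS.
  have := ec _ jS; have := ec _ iS; rewrite !dE !eqxx ji eq_sym ji.
  rewrite subr0 sub0r mulr1 mulrN1 => <- /esym/eqP.
  by rewrite oppr_eq0 oner_eq0.
(* Otherwise [d] is a nonzero boundary supported outside [S]. *)
have some : ([set i] \in S) || ([set j] \in S).
  apply/negPn/negP; rewrite negb_or => /andP[iS jS].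
  have : d \in 0%VS.
    rewrite -cap0 memv_cap memv_line andbT mem_face_span.
    apply/forall_inP=> u; rewrite dE inE negb_and negbK.
    have [->|_] := eqVneq u [set i]; first by rewrite (negPf iS) set1_faces.
    have [->|_] := eqVneq u [set j]; first by rewrite (negPf jS) set1_faces.
    by rewrite subrr.
  rewrite memv0 => /eqP/ffunP/(_ [set i])/eqP.
  by rewrite dE ffunE eqxx [_ == [set j]]eq_sym ji subr0 oner_eq0.
have [iS|iS] := boolP ([set i] \in S).
  left; apply/eqP/setP=> t; rewrite inE; apply/idP/eqP=> [tS|-> //].
  by case/orP: (S_sub t tS) => /eqP // tj; rewrite iS -tj tS in not_both.
right; apply/eqP/setP=> t; rewrite inE; apply/idP/eqP=> [tS|->].
  by case/orP: (S_sub t tS) => /eqP // ti; rewrite -ti tS in iS.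
by rewrite (negPf iS) in some.
Qed.

(** * Circuits, shrubs and hedges in the lowest dimension *)

Lemma circuit_set0 : circuit F leT set0 set0 = face_chain F (set0 : {set V}).
Proof.
rewrite /circuit; set P := (X in epsilon _ X).
have [|_ [y]] := epsilon_spec (inhabits 0) P.
  exists (face_chain F set0); split.
    by rewrite boundary_face_chain face_boundary0.
  by exists 0; rewrite ?subr0 // mem0v.
by rewrite face_span0 memv0 => /eqP-> ->; rewrite subr0.
Qed.

Lemma shrub_size1 v :
  shrub F leT [set set0] [set [set v]] set0 = face_chain F [set v].
Proof.
rewrite /shrub; set P := (X in epsilon _ X).
have [|+ + _] := epsilon_spec (inhabits 0) P.
  exists (face_chain F [set v]); split.
  - by rewrite face_span1 memv_line.
  - by rewrite boundary_face_chain face_boundary1 face_chainE eqxx.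
  - by move=> u; rewrite inE => /eqP->; rewrite eqxx.
rewrite face_span1 => /vlineP[c ->].
rewrite boundaryZ boundary_face_chain face_boundary1 chainZE face_chainE.
by rewrite eqxx mulr1 => ->; rewrite scale1r.
Qed.

Lemma is_hedge_vertex K v h : set0 \in K -> [set v] \in K ->
  is_hedge F leT 0 K h =
    [&& h.1 == [set set0], h.2 \subset faces 1 K & #|h.2| == 1%N].
Proof.
move=> K0 Kv; rewrite /is_hedge (is_stake_set_size0 _ K0 Kv).
by rewrite (is_shrubbery_size1 _ Kv).
Qed.

(** The stake set is forced to be the empty face, so a hedge is the choice of one vertex. *)
Lemma card_hedges K v : set0 \in K -> [set v] \in K ->
  #|[pred h | is_hedge F leT 0 K h]| = #|faces 1 K|.
Proof.
move=> K0 Kv; pose f (t : {set V}) := ([set set0 : {set V}], [set t]).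
have f_inj : injective f by move=> t u [] /set1_inj.
rewrite -(card_imset _ f_inj); apply: eq_card => -[S T].
rewrite inE (is_hedge_vertex _ K0 Kv) /=.
apply/and3P/imsetP=> [[/eqP-> sT /cards1P[t Tt]] | [t tK [-> ->]]].
  by exists t; rewrite ?Tt // -sub1set -Tt.
by rewrite eqxx sub1set tK cards1.
Qed.

End Chains.

(** * Words in two letters *)

Section WordCounting.

Local Open Scope nat_scope.

(** Serves two counts: words with a prescribed prefix, and families of hedges along a path. *)
Lemma card_tuple_family (T : finType) (x0 : T) n (P : nat -> pred T) :
  #|[set t : n.-tuple T | [forall q : 'I_n, P q (nth x0 t q)]]| =
    \prod_(q < n) #|P q|.
Proof.
pose f (g : {ffun 'I_n -> T}) : n.-tuple T := [tuple g q | q < n].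
have f_inj : injective f.
  move=> g h e; apply/ffunP=> q.
  by rewrite -[g q](tnth_mktuple g) -/(f g) e tnth_mktuple.
transitivity #|[set f g | g in family (fun q : 'I_n => P q)]|.
  apply: eq_card => t; rewrite !inE; apply/forallP/imsetP=> [Pt | [g gP ->] q].
    exists [ffun q => tnth t q].
      by apply/familyP=> q; rewrite ffunE (tnth_nth x0); apply: Pt.
    by apply: eq_from_tnth => q; rewrite tnth_mktuple ffunE.
  by rewrite -tnth_nth /f tnth_mktuple; apply: (familyP gP).
rewrite card_imset // card_family foldrE big_image.
by apply: eq_bigl.
Qed.

Lemma prod_if_const (p q m r : nat) :
  \prod_(l < m) (if l < r then p else q) = p ^ minn r m * q ^ (m - r).
Proof.
elim: m => [|m IH]; first by rewrite big_ord0 minn0 sub0n.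
rewrite big_ord_recr /= {}IH.
have [mr|rm] := boolP (m < r); last first.
  rewrite -leqNgt in rm; have -> : minn r m.+1 = minn r m by lia.
  by rewrite subSn // expnSr mulnA.
have -> : m - r = 0 by lia.
have -> : m.+1 - r = 0 by lia.
have -> : minn r m.+1 = (minn r m).+1 by lia.
by rewrite expn0 !muln1 expnSr.
Qed.

Section Words.

Variables (T : finType) (i j : T).
Hypothesis ij : i != j.
Implicit Types (u w : seq T) (r x y : nat).

Lemma count_take_le a r r' w : r <= r' -> count a (take r w) <= count a (take r' w).
Proof.
by move=> rr; rewrite -(subnKC rr) takeD count_cat leq_addr.
Qed.

Lemma count_takeE a r w : count a (take r w) <= count a w.
Proof. by rewrite -{2}(cat_take_drop r w) count_cat leq_addr. Qed.

Definition letters_in w := all (fun v => v \in [:: i; j]) w.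

Lemma letters_in_take r w : letters_in w -> letters_in (take r w).
Proof. by rewrite /letters_in -{1}(cat_take_drop r w) all_cat => /andP[]. Qed.

Lemma letters_in_count w : letters_in w -> count_mem i w + count_mem j w = size w.
Proof.
rewrite /letters_in.
elim: w => //= v w IH /andP[+ /IH <-]; rewrite !inE.
by case/orP => /eqP ->; rewrite eqxx ?(negPf ij) 1?eq_sym ?(negPf ij); lia.
Qed.

(** With one letter absent there is no order to choose; this describes the forced tail of a path
    after its stop. *)
Lemma letters_in_nseq w :
    letters_in w -> (count_mem i w == 0) || (count_mem j w == 0) ->
  w = nseq (count_mem i w) i ++ nseq (count_mem j w) j.
Proof.
move=> tw /orP[] /eqP e; have := letters_in_count tw; rewrite e => sw.
  have : all (pred1 j) w by rewrite all_count -sw ?addn0.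
  by move=> /all_pred1P; rewrite -sw.
have : all (pred1 i) w by rewrite all_count -sw ?addn0.
by move=> /all_pred1P; rewrite -sw addn0 cats0.
Qed.

Lemma card_letters_in m u : letters_in u -> size u <= m ->
  #|[set w : m.-tuple T | letters_in w && (take (size u) w == u)]| =
    2 ^ (m - size u).
Proof.
move=> tu um.
pose P q := [pred v | (v \in [:: i; j]) && ((q < size u) ==> (v == nth i u q))].
transitivity #|[set w : m.-tuple T | [forall q : 'I_m, P q (nth i w q)]]|.
  apply: eq_card => w; rewrite !inE; apply/andP/forallP=> [[tw /eqP uw] q | Pw].
    rewrite /P /= (allP tw) ?mem_nth ?size_tuple //.
    by apply/implyP=> qu; rewrite -uw nth_take.
  split; first apply/allP=> v /(nthP i)[q qm <-].
    by rewrite size_tuple in qm; case/andP: (Pw (Ordinal qm)).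
  apply/eqP/(@eq_from_nth _ i) => [|q].
    by rewrite size_takel ?size_tuple.
  rewrite size_takel ?size_tuple // => qu.
  rewrite nth_take //; have qm' : q < m := leq_trans qu um.
  by case/andP: (Pw (Ordinal qm')) => _ /=; rewrite qu => /eqP.
rewrite (card_tuple_family i m P).
rewrite (eq_bigr (fun q : 'I_m => if q < size u then 1 else 2)).
  by rewrite prod_if_const exp1n mul1n.
move=> q _; case: ltnP => qu.
  rewrite -(card1 (nth i u q)); apply: eq_card => v; rewrite !inE qu /= andbC.
  by case: eqP => // ->; have := allP tu _ (mem_nth i qu); rewrite !inE.
transitivity #|pred2 i j|; last by rewrite card2 ij.
by apply: eq_card => v; rewrite !inE ltnNge qu /= andbT.
Qed.

End Words.

End WordCounting.

(** * Walks in a staircase *)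

Section Staircase.

Local Open Scope nat_scope.

Variables (T : finType) (i j : T) (s : nat) (al be : nat -> nat).
Implicit Types (u w : seq T) (r x y p q : nat).

Local Notation ij_word := (letters_in i j).

(* The point (x, y) stands for the degree b - x e_i - y e_j, and (al p, be p)
   for the generator a_p; a degree is live when both i and j are vertices of its
   Koszul complex. *)
Definition inside x y := has (fun p => (x <= al p) && (y <= be p)) (iota 0 s).

Definition live x y := inside x.+1 y && inside x y.+1.

Definition live_word w := live (count_mem i w) (count_mem j w).

(** The counterpart of |b - b_lambda|. Its value is [(size w).+1] when every prefix is live, hence
    the recurring condition [stop w <= size w]. *)
Definition stop w :=
  find (fun r => ~~ live_word (take r w)) (iota 0 (size w).+1).

Definition path_to p w :=
  [&& ij_word w, count_mem i w == al p & count_mem j w == be p].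

Lemma insideP x y :
  reflect (exists p, [/\ p < s, x <= al p & y <= be p]) (inside x y).
Proof.
apply: (iffP hasP) => [[p]|[p [ps xp yp]]].
  by rewrite mem_iota add0n => ps /andP[xp yp]; exists p.
by exists p; rewrite ?mem_iota ?xp.
Qed.

Lemma inside_le x x' y y' : x <= x' -> y <= y' -> inside x' y' -> inside x y.
Proof.
move=> xx yy /insideP[p [ps xp yp]]; apply/insideP; exists p.
by split=> //; lia.
Qed.

Lemma live_le x x' y y' : x <= x' -> y <= y' -> live x' y' -> live x y.
Proof.
move=> xx yy /andP[l1 l2].
by apply/andP; split; [apply: inside_le l1 | apply: inside_le l2].
Qed.

Lemma live_word_take_le r r' w :
  r <= r' -> live_word (take r' w) -> live_word (take r w).
Proof. by move=> rr; apply: live_le; apply: count_take_le. Qed.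

Lemma stop_lt r w : r < stop w -> live_word (take r w).
Proof.
move=> rw; have := before_find 0 rw; rewrite nth_iota => [|]; last first.
  by apply: leq_trans rw _; rewrite -[X in _ <= X](size_iota 0) find_size.
by rewrite add0n => /negbFE.
Qed.

Lemma stop_not_live w : stop w <= size w -> ~~ live_word (take (stop w) w).
Proof.
move=> sw; have : has (fun r => ~~ live_word (take r w)) (iota 0 (size w).+1).
  by rewrite has_find size_iota ltnS.
by move/(nth_find 0); rewrite -/(stop w) nth_iota ?ltnS.
Qed.

Lemma stop_gt r w : r <= size w -> live_word (take r w) -> r < stop w.
Proof.
move=> rw lr; rewrite ltnNge; apply/negP=> sr.
have := stop_not_live (leq_trans sr rw).
by rewrite (live_word_take_le sr lr).
Qed.

Lemma stop_le r w : ~~ live_word (take r w) -> stop w <= r.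
Proof. by move=> nl; rewrite leqNgt; apply: contra nl; apply: stop_lt. Qed.

Lemma stop_prefix w w' : stop w <= size w ->
  take (stop w) w = take (stop w) w' -> stop w <= size w' -> stop w' = stop w.
Proof.
move=> sw e sw'; apply/eqP; rewrite eqn_leq stop_le -?e ?stop_not_live //=.
case es: (stop w) => [|r] //; apply: stop_gt; first by lia.
have rs : r <= stop w by lia.
rewrite -(take_takel w' rs) -e take_takel //; apply: stop_lt; lia.
Qed.

Hypothesis al_inc : forall p q, p < q < s -> al p < al q.
Hypothesis be_dec : forall p q, p < q < s -> be q < be p.

(** Being live would require another generator with larger [al] and no smaller [be], against the
    opposite monotonicity. Hence every path to a generator stops by its end. *)
Lemma not_live_corner p : p < s -> ~~ live (al p) (be p).
Proof.
move=> ps; apply/negP=> /andP[/insideP[q [qs aq bq]] _].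
case: (ltngtP p q) => [pq|qp|pq]; last by subst; lia.
  by have := @be_dec p q; lia.
by have := @al_inc q p; lia.
Qed.

Lemma path_to_stop p w : p < s -> path_to p w -> stop w <= size w.
Proof.
move=> ps /and3P[_ /eqP ei /eqP ej]; apply: stop_le.
by rewrite take_size /live_word ei ej not_live_corner.
Qed.

Hypothesis ij : i != j.

Let ji : (j == i) = false.
Proof. by rewrite eq_sym (negPf ij). Qed.

(** The order of the two blocks is a convention: once [w] is no longer live but still within reach
    of [p], [not_live_edge] makes one block empty. *)
Definition complete_path p w :=
  w ++ nseq (al p - count_mem i w) i ++ nseq (be p - count_mem j w) j.

Lemma path_to_complete p w : ij_word w ->
  count_mem i w <= al p -> count_mem j w <= be p -> path_to p (complete_path p w).
Proof.
move=> tw ip jp; rewrite /path_to; have -> : ij_word (complete_path p w).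
  by rewrite /letters_in !all_cat !all_nseq !inE !eqxx !orbT -/(ij_word w) tw.
rewrite !count_cat !count_nseq /= !eqxx.
rewrite (negPf ij) ji !mul1n !mul0n.
by rewrite addn0 add0n !subnKC ?eqxx.
Qed.

(** If [p < q] both bound the point, then [al q] leaves room for one more [i] and [be p] for one
    more [j], so the point is live. Past its stop a path thus has only one possible target. *)
Lemma not_live_index p q x y : live x y = false -> p < s -> q < s ->
  x <= al p -> y <= be p -> x <= al q -> y <= be q -> p = q.
Proof.
suff {p q} H p q : p < q -> live x y = false -> p < s -> q < s ->
  x <= al p -> y <= be p -> x <= al q -> y <= be q -> False.
  move=> nl ps qs *; case: (ltngtP p q) => [pq|qp|//].
    by case: (H p q).
  by case: (H q p).
move=> pq /negbT nl ps qs xp yp xq yq; case/negP: nl; apply/andP; split.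
  by apply/insideP; exists q; split=> //; have := @al_inc p q; lia.
by apply/insideP; exists p; split=> //; have := @be_dec p q; lia.
Qed.

Lemma not_live_edge p x y : ~~ live x y -> p < s -> x <= al p -> y <= be p ->
  (x == al p) || (y == be p).
Proof.
move=> nl ps xp yp; apply: contraNT nl; rewrite negb_or => /andP[xa yb].
by apply/andP; split; apply/insideP; exists p; split=> //; lia.
Qed.

(** * Words of length [m], for [m] a bound on all the stops *)

Section Walks.

Variable m : nat.
Hypothesis stop_le_m : forall p w, p < s -> path_to p w -> stop w <= m.

(** A live word extends to a path to some generator, and that path stops strictly later, but within
    [m] steps. *)
Lemma live_word_size w : ij_word w -> live_word w -> size w < m.
Proof.
move=> tw lw; have /andP[/insideP[p [ps ip jp]] _] := lw.
have pw := path_to_complete tw (ltnW ip) jp.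
apply: leq_trans (stop_le_m ps pw); apply: stop_gt.
  by rewrite size_cat leq_addr.
by rewrite take_size_cat.
Qed.

(** The syzygy is live: an [i] step stays above generator [p.+1] and a [j] step above generator [p].
    Hence a word of length [m] has a step left after passing it. *)
Lemma corner_size p : p.+1 < s -> al p + be p.+1 < m.
Proof.
move=> ps; have tw : ij_word (nseq (al p) i ++ nseq (be p.+1) j).
  by rewrite /letters_in all_cat !all_nseq !inE !eqxx !orbT.
have := live_word_size tw; rewrite size_cat !size_nseq; apply.
rewrite /live_word !count_cat !count_nseq /= !eqxx (negPf ij) ji.
rewrite !mul1n !mul0n addn0 add0n; apply/andP; split; apply/insideP.
  by exists p.+1; split=> //; have := @al_inc p p.+1; lia.
by exists p; split=> //; [lia | have := @be_dec p p.+1; lia].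
Qed.

Lemma walk_stop w : ij_word w -> m <= size w -> stop w <= m.
Proof.
move=> tw mw; apply: stop_le; apply/negP=> /live_word_size.
by rewrite letters_in_take // size_takel // ltnn => /(_ isT).
Qed.

(* The corner (al p, be p.+1) is the syzygy of a_p and a_p.+1.  Passing it on one
   side, or leaving it in that direction, is the same as being strictly beyond
   it in that coordinate one step later; this makes the two sides complementary. *)
Definition side_j p w := be p.+1 < count_mem j (take (al p + be p.+1).+1 w).
Definition side_i p w := al p < count_mem i (take (al p + be p.+1).+1 w).

(** The degree just before the stop is live, so both of its successors are in the ideal, and the
    stop is one of them. *)
Lemma stop_inside w : 0 < s -> ij_word w -> stop w <= size w ->
  inside (count_mem i (take (stop w) w)) (count_mem j (take (stop w) w)).
Proof.
move=> s0 tw sw; case es: (stop w) => [|r].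
  by rewrite take0; apply/insideP; exists 0.
have rw : r < size w by lia.
have /andP[l1 l2] : live_word (take r w) by apply: stop_lt; lia.
rewrite (take_nth i rw) -cats1 !count_cat /=.
have /(allP tw) := mem_nth i rw; rewrite !inE => /orP[] /eqP ->.
  by rewrite eqxx (negPf ij) !addn0 addn1.
by rewrite eqxx ji !addn0 addn1.
Qed.

Lemma take_count w r : ij_word w -> r <= size w ->
  count_mem i (take r w) + count_mem j (take r w) = r.
Proof.
by move=> tw rm; rewrite letters_in_count ?letters_in_take // size_takel.
Qed.

(** One step past the corner the two counts add up to [(al q + be q.+1).+1], which is too small for
    both to exceed their corner values. *)
Lemma sides_exclusive w q : ij_word w -> size w = m -> q.+1 < s ->
  side_i q w -> side_j q w -> False.
Proof.
rewrite /side_i /side_j => tw wm /corner_size; rewrite -wm.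
move=> /(take_count tw); move: (count_mem i _) (count_mem j _) => x y; lia.
Qed.

(** * Words whose stop is within reach of a given generator [p] *)

Section Side.

Variables (w : seq T) (p : nat).
Hypotheses (tw : ij_word w) (wm : size w = m) (ps : p < s).
Hypothesis ip : count_mem i (take (stop w) w) <= al p.
Hypothesis jp : count_mem j (take (stop w) w) <= be p.

Let stop_size : stop w <= size w.
Proof. by rewrite wm walk_stop ?wm. Qed.

Let unique q : q < s -> count_mem i (take (stop w) w) <= al q ->
  count_mem j (take (stop w) w) <= be q -> p = q.
Proof.
have /negbTE := stop_not_live stop_size.
by move=> nl qs iq jq; apply: not_live_index nl _ _ _ _ _ _.
Qed.

(** If the word stops by one step past the corner, too few letters [j] would put its stop within
    reach of [q.+1] as well, against [unique]. If it stops later, at most [al p <= al q] letters [i]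
    have occurred, and the rest are [j]. *)
Lemma side_j_ge q : p <= q -> q.+1 < s -> side_j q w.
Proof.
move=> pq qs; have Rm := corner_size qs; rewrite /side_j.
have apq : al p <= al q.
  by move: pq; rewrite leq_eqVlt => /orP[/eqP-> //|pq]; have := @al_inc p q; lia.
have tc := take_count tw (r := (al q + be q.+1).+1).
case: (leqP (stop w) (al q + be q.+1).+1) => sR.
  have jR := @count_take_le _ (pred1 j) _ _ w sR.
  rewrite ltnNge; apply/negP=> jq.
  have e : p = q.+1; last by rewrite e ltnn in pq.
  have aq : al q <= al q.+1 by rewrite ltnW // al_inc // ltnSn.
  exact: unique qs (leq_trans ip (leq_trans apq aq)) (leq_trans jR jq).
rewrite wm in tc; have e := tc Rm.
have ic := @count_take_le _ (pred1 i) _ _ w (ltnW sR).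
rewrite -(ltn_add2l (count_mem i (take (al q + be q.+1).+1 w))) e.
rewrite ltnS leq_add2r; exact: leq_trans ic (leq_trans ip apq).
Qed.

(** The mirror image of [side_j_ge], with the two letters exchanged. *)
Lemma side_i_lt q : q < p -> side_i q w.
Proof.
move=> qp; have qs : q.+1 < s by lia.
have Rm := corner_size qs; rewrite /side_i.
have bpq : be p <= be q.+1.
  move: qp; rewrite leq_eqVlt => /orP[/eqP-> //|qp].
  by have := @be_dec q.+1 p; lia.
have tc := take_count tw (r := (al q + be q.+1).+1).
case: (leqP (stop w) (al q + be q.+1).+1) => sR.
  have iR := @count_take_le _ (pred1 i) _ _ w sR.
  rewrite ltnNge; apply/negP=> iq.
  have e : p = q; last by rewrite e ltnn in qp.
  have bq : be q.+1 <= be q by rewrite ltnW // be_dec // ltnSn.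
  exact: unique (ltnW qs) (leq_trans iR iq) (leq_trans jp (leq_trans bpq bq)).
rewrite wm in tc; have e := tc Rm.
have jc := @count_take_le _ (pred1 j) _ _ w (ltnW sR).
rewrite -(ltn_add2r (count_mem j (take (al q + be q.+1).+1 w))) e.
rewrite ltnS leq_add2l; exact: leq_trans jc (leq_trans jp bpq).
Qed.

End Side.

Definition between l w := [&& ij_word w, (0 < l) ==> side_i l.-1 w
  & (l.+1 < s) ==> side_j l w].

Variable l : nat.
Hypothesis ls : l < s.

Lemma betweenP w : ij_word w -> size w = m ->
  between l w = (count_mem i (take (stop w) w) <= al l) &&
    (count_mem j (take (stop w) w) <= be l).
Proof.
move=> tw wm; apply/and3P/andP=> [[_ /implyP wi /implyP wj] | [il jl]]; last first.
  split=> //; apply/implyP=> l0.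
    by apply: (side_i_lt tw wm ls); lia.
  exact: (side_j_ge tw wm ls).
have sw : stop w <= size w by rewrite wm walk_stop ?wm.
have /insideP[p [ps ip jp]] := stop_inside (leq_ltn_trans (leq0n l) ls) tw sw.
(* The stop is within reach of some [p]. If [p] were beyond [l], the word would be on both sides of
   corner [l]; if [p] were before [l], on both sides of corner [l.-1]. *)
suff -> : l = p by [].
case: (ltngtP l p) => // [lp|pl].
  have l1 : l.+1 < s by lia.
  by case: (sides_exclusive tw wm l1 (side_i_lt tw wm ps ip jp lp) (wj l1)).
have l1 : l.-1.+1 < s by lia.
have l0 : 0 < l by lia.
have lp : p <= l.-1 by lia.
by case: (sides_exclusive tw wm l1 (wi l0) (side_j_ge tw wm ps ip jp lp l1)).
Qed.

(* Both sides count the pairs of a path v and a word w that agree on the first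
   stop v letters: a word determines at most one such path. *)
Lemma card_between n : n = al l + be l ->
  \sum_(v : n.-tuple T | path_to l v) 2 ^ (m - stop v) =
    #|[set w : m.-tuple T | between l w]|.
Proof.
move=> nE.
pose R (v : n.-tuple T) (w : m.-tuple T) :=
  ij_word w && (take (stop v) w == take (stop v) v).
transitivity (\sum_(v : n.-tuple T | path_to l v) \sum_(w | R v w) 1).
  apply: eq_bigr => v pv; have sv := path_to_stop ls pv.
  have szt : size (take (stop v) v) = stop v by rewrite size_takel.
  have /and3P[tv _ _] := pv.
  have := card_letters_in ij (letters_in_take (stop v) tv).
  move=> /(_ m); rewrite szt (stop_le_m ls pv) => /(_ isT) <-.
  by rewrite -sum1_card; apply: eq_bigl => w; rewrite inE.
(* For each word [w] it remains to find exactly one matching path when [w] is between the syzygies,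
   and none otherwise. *)
rewrite (exchange_big_dep xpredT) //= -sum1_card [RHS]big_mkcond /=.
apply: eq_bigr => w _; rewrite sum1_card inE.
have wm := size_tuple w.
have RE (v : n.-tuple T) : path_to l v -> R v w ->
    [/\ stop w = stop v, take (stop v) w = take (stop v) v & between l w].
  move=> pv /andP[tw /eqP wv]; have sv := path_to_stop ls pv.
  have ws : stop w = stop v.
    by apply: stop_prefix; rewrite ?wv // wm (stop_le_m ls pv).
  split=> //; rewrite betweenP // ws wv.
  by case/and3P: pv => _ /eqP <- /eqP <-; rewrite !count_takeE.
case: ifPn => [bw | nbw]; last first.
  apply: eq_card0 => v; rewrite !inE; apply/negP=> /andP[pv Rv].
  by case: (RE v pv Rv) => _ _; apply/negP.
have tw : ij_word w by case/and3P: bw.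
move: (bw); rewrite betweenP // => /andP[il jl].
have sw : stop w <= size w by rewrite wm walk_stop ?wm.
(* The only matching path is the completion of the prefix [c] up to the stop. *)
set c := take (stop w) w in il jl.
have tc : ij_word c by apply: letters_in_take.
have pc := path_to_complete tc il jl.
have sc : size (complete_path l c) == n.
  by case/and3P: pc => /(letters_in_count ij) <- /eqP -> /eqP ->; rewrite nE.
have szc : size c = stop w by rewrite size_takel.
have ec : take (stop w) (complete_path l c) = c by rewrite -szc take_size_cat.
have stc : stop (complete_path l c) = stop w.
  by apply: stop_prefix => //; rewrite -szc size_cat leq_addr.
rewrite -(card1 (Tuple sc)); apply: eq_card => v; rewrite !inE.
apply/andP/eqP=> [[pv Rv] | ->]; last first.
  by rewrite /R /= stc ec tw /c eqxx.
have [wv tv _] := RE v pv Rv; apply: val_inj => /=.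
have dv : v = c ++ drop (stop w) v :> seq T.
  by rewrite /c wv tv cat_take_drop.
have /and3P[twv /eqP iv /eqP jv] := pv.
move: twv iv jv; rewrite dv /letters_in all_cat !count_cat => /andP[_ tdv] iv jv.
rewrite /complete_path; congr (_ ++ _); rewrite {1}(letters_in_nseq ij tdv) -?iv -?jv.
  by rewrite !addKn.
(* One coordinate of the stop already equals that of the generator, so the tail of [v] uses a single
   letter. *)
have := not_live_edge (stop_not_live sw) ls il jl.
by rewrite -/c => /orP[/eqP e|/eqP e]; apply/orP; [left|right]; apply/eqP; lia.
Qed.

End Walks.

End Staircase.

(** * Monomial ideals in three variables *)

Section Coordinates.

Local Open Scope nat_scope.

Variables (i j k : 'I_3).
Hypothesis ijk_uniq : uniq [:: i; j; k].
Implicit Types (c a b sg : 'X_{1..3}) (w : seq 'I_3).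

Lemma perm_ijk : perm_eq (index_enum 'I_3) [:: i; j; k].
Proof.
apply: uniq_perm => //; first exact: index_enum_uniq.
have sub : {subset [:: i; j; k] <= index_enum 'I_3} by move=> v; rewrite mem_index_enum.
have [|_ e] := uniq_min_size ijk_uniq sub; last by move=> v; rewrite e.
by rewrite /index_enum -enumT size_enum_ord.
Qed.

Lemma ijk_cover v : [|| v == i, v == j | v == k].
Proof. by have := perm_mem perm_ijk v; rewrite mem_index_enum !inE => <-. Qed.

Lemma ijk_neq : [/\ i != j, i != k & j != k].
Proof.
by move: ijk_uniq; rewrite /= !inE negb_or andbT => /andP[/andP[-> ->] ->].
Qed.

Lemma mdeg_ijk c : mdeg c = c i + c j + c k.
Proof.
by rewrite mdegE (perm_big _ perm_ijk) !big_cons big_nil /= addn0 addnA.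
Qed.

Lemma forall_ijk (P : pred 'I_3) : [forall v, P v] = [&& P i, P j & P k].
Proof.
apply/forallP/and3P=> [Pv | [Pi Pj Pk] v]; first by split.
by case/or3P: (ijk_cover v) => /eqP->.
Qed.

Lemma lem_ijk a b : (a <= b)%MM = [&& a i <= b i, a j <= b j & a k <= b k].
Proof. exact: forall_ijk. Qed.

Lemma mnm_ijk a b : a i = b i -> a j = b j -> a k = b k -> a = b.
Proof.
move=> ei ej ek; apply/mnmP=> v.
by case/or3P: (ijk_cover v) => /eqP->.
Qed.

Lemma letters_in_count_k w : letters_in i j w = (count_mem k w == 0).
Proof.
have [_ ik jk] := ijk_neq.
rewrite /letters_in eqn0Ngt -has_count -all_predC; apply: eq_all => v.
rewrite !inE /=; have := ijk_cover v.
have [->|_] := eqVneq v k; last by rewrite orbF.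
by rewrite eq_sym (negPf ik) eq_sym (negPf jk).
Qed.

(** After |b - sg| steps the count of [j] determines the point, so equality with [b j - sg j] means
    being at [sg]. Exceeding this value one step later thus means having exceeded it already, or
    leaving [sg] along [j]. The bound on [size w] ensures that this step exists. *)
Lemma takes_sideE b sg w : (sg <= b)%MM -> sg k = b k -> letters_in i j w ->
    b i - sg i + (b j - sg j) < size w ->
  takes_side b sg j w =
    (b j - sg j < count_mem j (take (b i - sg i + (b j - sg j)).+1 w)).
Proof.
move=> sgb sgk tw rw; have [ij ik jk] := ijk_neq.
have rE : mdeg (b - sg)%MM = b i - sg i + (b j - sg j).
  by rewrite mdeg_ijk !mnmBE sgk subnn addn0.
rewrite /takes_side rE; set r := b i - sg i + (b j - sg j) in rw *; clear rE.
rewrite forall_ijk /grid_point.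
have := letters_in_take r tw; rewrite letters_in_count_k => /eqP->.
have := letters_in_count ij (letters_in_take r tw); rewrite (size_takel (ltnW rw)).
rewrite (take_nth i rw) -cats1 count_cat /=.
have -> : onth w r = Some (nth i w r) by rewrite onthE (nth_map i).
move: sgb; rewrite lem_ijk sgk => /and3P[sgi sgj _].
have /(allP tw) := mem_nth i rw; rewrite !inE.
rewrite /r; clear r rw; move: (nth _ _ _) => v.
move: (count_mem i _) (count_mem j _) => x y vij xy.
have -> : (Some v == Some j) = (v == j) by [].
case/orP: vij => /eqP ->; rewrite ?eqxx ?(negPf ij) ?andbF ?orbF; lia.
Qed.

End Coordinates.

(** * Monomial ideals, minimal generators and membership in Koszul complexes *)

Section Ideal.

Local Open Scope nat_scope.

Variables (F : fieldType) (I : {pred {mpoly F[3]}}).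
Hypothesis I_mon : monomial_ideal I.
Implicit Types (a b c u : 'X_{1..3}) (t : {set 'I_3}).

Lemma monomial_ideal_le a c : 'X_[a] \in I -> (a <= c)%MM -> 'X_[c] \in I.
Proof.
have [G GP] := I_mon; move=> /GP[s [sG e]] ac; apply/GP.
exists [seq ('X_[c - a] * x.1, x.2)%R | x <- s]; split.
  by move=> x /mapP[y ys ->] /=; exact: (sG y ys).
rewrite big_map /=; under eq_bigr do rewrite -mulrA.
by rewrite -mulr_sumr -e -mpolyXD submK.
Qed.

Lemma min_generator_exists c : 'X_[c] \in I ->
  exists2 g, min_generator I g & (g <= c)%MM.
Proof.
have [n] := ubnP (mdeg c); elim: n c => // n IH c cn cI.
have [cmin|] := classic (min_generator I c); first by exists c; rewrite ?lepm_refl.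
move=> ncmin; have [u [uc uI une]] :
    exists u, [/\ (u <= c)%MM, 'X_[u] \in I & u != c].
  apply: NNPP => no; apply: ncmin; split=> // u uc uI; apply/eqP.
  by apply/negPn/negP=> une; apply: no; exists u.
have [|g gmin gu] := IH u _ uI; last first.
  by exists g => //; apply: lepm_trans gu uc.
rewrite ltnS in cn; apply: leq_trans cn.
rewrite -(submK uc) mdegD -[X in X < _]add0n ltn_add2r.
rewrite lt0n mdeg_eq0; apply: contraNneq une => e.
by rewrite -(submK uc) e add0m.
Qed.

Lemma in_koszul t c :
  (t \in koszul I c) = (indicator t <= c)%MM && ('X_[(c - indicator t)%MM] \in I).
Proof. by rewrite inE. Qed.

Lemma indicatorE t v : indicator t v = (v \in t).
Proof. by rewrite mnmE. Qed.

Lemma set0_koszul c : (set0 \in koszul I c) = ('X_[c] \in I).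
Proof.
have i0 : indicator set0 = 0%MM.
  by apply/mnmP=> v; rewrite indicatorE inE mnm0E.
rewrite in_koszul i0 subm0 (_ : (0 <= c)%MM) //.
by apply/mnm_lepP=> v; rewrite mnm0E.
Qed.

Lemma set1_koszul c v :
  ([set v] \in koszul I c) = (0 < c v) && ('X_[(c - U_(v))%MM] \in I).
Proof.
have i1 : indicator [set v] = U_(v)%MM.
  by apply/mnmP=> u; rewrite indicatorE inE mnm1E eq_sym.
by rewrite in_koszul i1 lep1mP -lt0n.
Qed.

Lemma set2_koszul c (u v : 'I_3) : u != v -> 0 < c u -> 0 < c v ->
  'X_[(c - U_(u) - U_(v))%MM] \in I -> [set u; v] \in koszul I c.
Proof.
move=> uv cu cv cI.
have i2 : indicator [set u; v] = (U_(u) + U_(v))%MM.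
  apply/mnmP=> w; rewrite indicatorE !inE mnmDE !mnm1E ![_ == w]eq_sym.
  by case: (eqVneq w u) => // ->; rewrite (negPf uv).
rewrite in_koszul i2 -submDA cI andbT; apply/mnm_lepP=> w; rewrite mnmDE !mnm1E.
have [<-|_] := eqVneq u w; first by rewrite [v == u]eq_sym (negPf uv).
by have [<-|] := eqVneq v w.
Qed.

Lemma koszul_sub t t' c : t' \subset t -> t \in koszul I c -> t' \in koszul I c.
Proof.
move=> tt'; rewrite !in_koszul => /andP[/mnm_lepP tc cI].
have le v : indicator t' v <= indicator t v.
  by rewrite !indicatorE; case: (boolP (v \in t')) => // /(subsetP tt') ->.
apply/andP; split; first by apply/mnm_lepP=> v; apply: leq_trans (le v) _.
apply: monomial_ideal_le cI _; apply/mnm_lepP=> v; rewrite !mnmBE.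
exact: leq_sub2l.
Qed.

End Ideal.

(** * The degrees below [b] with the same [k] coordinate, in staircase coordinates *)

Section Slice.

Local Open Scope nat_scope.

Variables (F : fieldType) (I : {pred {mpoly F[3]}}).
Hypothesis I_mon : monomial_ideal I.
Variables (i j k : 'I_3).
Hypothesis ijk_uniq : uniq [:: i; j; k].
Variable b : 'X_{1..3}.
Hypothesis Kb : facets (koszul I b) = [set [set i; j]; [set k]].
Variable gens : seq 'X_{1..3}.
Hypothesis gensP : forall u : 'X_{1..3},
  u \in gens <-> min_generator I u /\ lies_behind i j u b.
Hypothesis gens_sorted : sorted (fun u v : 'X_{1..3} => u j < v j) gens.
Implicit Types (w : seq 'I_3) (c : 'X_{1..3}).

Local Notation s := (size gens).
Local Notation gen p := (nth 0%MM gens p).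

Definition gen_dist (v : 'I_3) p := b v - gen p v.

Local Notation al := (gen_dist i).
Local Notation be := (gen_dist j).
Local Notation ij_word := (letters_in i j).
Local Notation inside := (inside s al be).
Local Notation alive := (live_word i j s al be).
Local Notation stop := (stop i j s al be).
Local Notation leads_to := (path_to i j al be).

Let ij : i != j. Proof. by case: (ijk_neq ijk_uniq). Qed.
Let ik : i != k. Proof. by case: (ijk_neq ijk_uniq). Qed.
Let jk : j != k. Proof. by case: (ijk_neq ijk_uniq). Qed.

Lemma facet_edge : [set i; j] \in koszul I b.
Proof.
have : [set i; j] \in facets (koszul I b) by rewrite Kb !inE eqxx.
by rewrite inE => /maxsetp.
Qed.

Lemma facet_vertex : [set k] \in koszul I b.
Proof.
have : [set k] \in facets (koszul I b) by rewrite Kb !inE eqxx orbT.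
by rewrite inE => /maxsetp.
Qed.

Lemma koszul_facet t : t \in koszul I b ->
  (t \subset [set i; j]) || (t \subset [set k]).
Proof.
move=> /(maxset_exists (P := fun u => u \in koszul I b))[u umax tu].
have : u \in facets (koszul I b) by rewrite inE.
by rewrite Kb !inE => /orP[] /eqP <-; rewrite tu ?orbT.
Qed.

Lemma koszul_vertex v : [set v] \in koszul I b.
Proof.
case/or3P: (ijk_cover ijk_uniq v) => /eqP->; last exact: facet_vertex.
  by apply: (koszul_sub I_mon _ facet_edge); rewrite sub1set !inE eqxx.
by apply: (koszul_sub I_mon _ facet_edge); rewrite sub1set !inE eqxx orbT.
Qed.

Lemma faces2_b : faces 2 (koszul I b) = [set [set i; j]].
Proof.
have c2 : #|[set i; j]| = 2 by rewrite cards2 ij.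
apply/setP=> t; rewrite !inE -in_koszul; apply/andP/eqP=> [[tK /eqP ct]|->].
  case/orP: (koszul_facet tK) => st.
    by apply/eqP; rewrite eqEcard st ct c2.
  by have := subset_leq_card st; rewrite ct cards1.
by rewrite facet_edge c2.
Qed.

Lemma genP p : p < s ->
  [/\ min_generator I (gen p), (gen p <= b)%MM & gen p k = b k].
Proof.
move=> ps; have [/(_ (mem_nth _ ps))[gmin [gb gk]] _] := gensP (gen p).
split=> //; apply/eqP; rewrite eqn_leq (mnm_lepP gb) -subn_eq0 -mnmBE.
apply/negPn/negP=> /gk; rewrite !inE ![k == _]eq_sym.
by rewrite (negPf ik) (negPf jk).
Qed.

Lemma gen_le p v : p < s -> gen p v <= b v.
Proof. by move=> ps; case: (genP ps) => _ /mnm_lepP. Qed.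

Lemma gen_antichain p q : p < s -> q < s -> (gen p <= gen q)%MM -> gen p = gen q.
Proof.
by move=> /genP[[pI _] _ _] /genP[[_ qmin] _ _] pq; apply: qmin.
Qed.

Lemma gen_j_lt p q : p < q < s -> gen p j < gen q j.
Proof.
case/andP=> pq qs; apply: (sorted_ltn_nth _ _ gens_sorted) => //.
  by move=> x y z; apply: ltn_trans.
exact: ltn_trans pq qs.
Qed.

(** Minimal generators are pairwise incomparable and these share their [k] coordinate, so [i] must
    decrease as [j] increases. *)
Lemma gen_i_gt p q : p < q < s -> gen q i < gen p i.
Proof.
move=> pqs; have /andP[pq qs] := pqs; have ps := ltn_trans pq qs.
have ltj := gen_j_lt pqs; rewrite ltnNge; apply/negP=> lei.
have e : gen p = gen q; last by rewrite e ltnn in ltj.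
apply: gen_antichain => //; rewrite (lem_ijk ijk_uniq) lei (ltnW ltj) /=.
by case: (genP ps) => _ _ ->; case: (genP qs) => _ _ ->.
Qed.

Lemma gen_dist_i_inc p q : p < q < s -> al p < al q.
Proof.
move=> pqs; have := gen_i_gt pqs; have /andP[pq qs] := pqs.
by have := gen_le i (ltn_trans pq qs); rewrite /gen_dist; lia.
Qed.

Lemma gen_dist_j_dec p q : p < q < s -> be q < be p.
Proof.
move=> pqs; have := gen_j_lt pqs; have /andP[pq qs] := pqs.
by have := gen_le j qs; rewrite /gen_dist; lia.
Qed.

Lemma no_mixed_edge v : v != k -> [set v; k] \notin koszul I b.
Proof.
move=> vk; apply/negP=> /koszul_facet/orP[] /subsetP.
  move/(_ k); rewrite !inE eqxx orbT ![k == _]eq_sym (negPf ik) (negPf jk).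
  by move=> /(_ isT).
by move/(_ v); rewrite !inE eqxx (negPf vk) => /(_ isT).
Qed.

(** Membership of [c] would put b - e_v - e_k in the ideal and make [{v, k}] an edge at [b]. *)
Lemma no_lower c v : v != k -> (c <= b)%MM -> c v < b v -> c k < b k ->
  'X_[c] \notin I.
Proof.
move=> vk cb cv ck; apply/negP=> cI; case/negP: (no_mixed_edge vk).
apply: set2_koszul => //; try exact: leq_ltn_trans cv; try exact: leq_ltn_trans ck.
apply: (monomial_ideal_le I_mon) cI _; apply/mnm_lepP=> u.
rewrite !mnmBE !mnm1E; have := mnm_lepP cb u.
have [<-|uv] := eqVneq v u; first by rewrite eq_sym (negPf vk); lia.
by have [<-|uk] := eqVneq k u; lia.
Qed.

Lemma slice_gen c : (c <= b)%MM -> c k = b k ->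
  ('X_[c] \in I) = has (fun a => (a <= c)%MM) gens.
Proof.
move=> cb ck; apply/idP/hasP=> [cI | [a /gensP[[aI _] _] ac]]; last first.
  exact: (monomial_ideal_le I_mon aI ac).
have [bi0 biI] : 0 < b i /\ 'X_[(b - U_(i))%MM] \in I.
  by apply/andP; rewrite -set1_koszul koszul_vertex.
(* To keep the generator below [c] from dropping in [k], [no_lower] needs another coordinate
   strictly below [b]. When [c] agrees with [b] in [i] and [j], b - e_i is used, which is in the
   ideal since [i] is a vertex. *)
have [c' [c'I c'c [v vk c'v]]] : exists c',
    [/\ 'X_[c'] \in I, (c' <= c)%MM & exists2 v, v != k & c' v < b v].
  have [ci|ci] := ltnP (c i) (b i).
    by exists c; split; rewrite ?lepm_refl //; exists i.
  have [cj|cj] := ltnP (c j) (b j).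
    by exists c; split; rewrite ?lepm_refl //; exists j.
  exists (b - U_(i))%MM; split=> //; last first.
    by exists i => //; rewrite mnmBE mnm1E eqxx; lia.
  rewrite (lem_ijk ijk_uniq) !mnmBE ck; lia.
have [g gmin gc'] := min_generator_exists c'I.
have gc := lepm_trans gc' c'c; have gb := lepm_trans gc cb.
exists g => //; apply/gensP; split=> //; split=> // u; rewrite mnmBE.
case/or3P: (ijk_cover ijk_uniq u) => /eqP->; rewrite ?inE ?eqxx ?orbT //.
rewrite subn_eq0 -ltnNge => gk.
have [gI _] := gmin; have := no_lower vk gb _ gk; rewrite gI.
by move=> /(_ (leq_ltn_trans (mnm_lepP gc' v) c'v)).
Qed.

Lemma slice_inside x y c : x <= b i -> y <= b j ->
  c i = b i - x -> c j = b j - y -> c k = b k -> ('X_[c] \in I) = inside x y.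
Proof.
move=> xb yb ci cj ck.
have cb : (c <= b)%MM by rewrite (lem_ijk ijk_uniq) ci cj ck !leq_subr leqnn.
rewrite slice_gen //; apply/hasP/insideP=> [[a ag ac] | [p [ps xp yp]]].
  have e := nth_index 0%MM ag; exists (index a gens).
  have ps : index a gens < s by rewrite index_mem.
  have := gen_le i ps; have := gen_le j ps; rewrite /gen_dist e.
  move: (mnm_lepP ac i) (mnm_lepP ac j); rewrite ci cj => *; split=> //; lia.
exists (gen p); first exact: mem_nth.
have := gen_le i ps; have := gen_le j ps; have [_ _ gk] := genP ps.
rewrite (lem_ijk ijk_uniq) ci cj ck gk; move: xp yp; rewrite /gen_dist; lia.
Qed.

(** * Vertices of the Koszul complex at a degree on a path *)

Section Point.

Variables (w : seq 'I_3) (r : nat).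
Hypothesis tw : ij_word w.
Local Notation x := (count_mem i (take r w)).
Local Notation y := (count_mem j (take r w)).
Hypotheses (xb : x <= b i) (yb : y <= b j).
Let c := path_degree b w r.

Let ci : c i = b i - x. Proof. by rewrite mnmBE mnmE. Qed.
Let cj : c j = b j - y. Proof. by rewrite mnmBE mnmE. Qed.
Let ck : c k = b k.
Proof.
rewrite mnmBE mnmE; have := letters_in_take r tw.
by rewrite (letters_in_count_k ijk_uniq) => /eqP->; rewrite subn0.
Qed.

Lemma point_set0 : (set0 \in koszul I c) = inside x y.
Proof. by rewrite set0_koszul (slice_inside xb yb). Qed.

Lemma point_i : ([set i] \in koszul I c) = inside x.+1 y.
Proof.
rewrite set1_koszul ci; have [xb'|xb'] := ltnP x (b i).
  rewrite subn_gt0 xb'; apply: (slice_inside xb' yb).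
  - by rewrite mnmBE mnm1E eqxx ci; lia.
  - by rewrite mnmBE mnm1E (negPf ij) cj subn0.
  - by rewrite mnmBE mnm1E (negPf ik) ck subn0.
(* With the exponent of [i] exhausted, both sides are false, since [al p] never exceeds [b i]. *)
rewrite subn_gt0 ltnNge xb'; apply/esym/negP=> /insideP[p [ps xp _]].
by move: xp; rewrite /gen_dist; lia.
Qed.

Lemma point_j : ([set j] \in koszul I c) = inside x y.+1.
Proof.
rewrite set1_koszul cj; have [yb'|yb'] := ltnP y (b j).
  rewrite subn_gt0 yb'; apply: (slice_inside xb yb').
  - by rewrite mnmBE mnm1E eq_sym (negPf ij) ci subn0.
  - by rewrite mnmBE mnm1E eqxx cj; lia.
  - by rewrite mnmBE mnm1E (negPf jk) ck subn0.
rewrite subn_gt0 ltnNge yb'; apply/esym/negP=> /insideP[p [ps _ yp]].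
by move: yp; rewrite /gen_dist; lia.
Qed.

(** One step has already lowered [i] or [j], so lowering [k] too is excluded by [no_lower]. *)
Lemma point_k : 0 < r <= size w -> [set k] \notin koszul I c.
Proof.
case/andP=> r0 rw; rewrite set1_koszul; apply/negP=> /andP[c0].
have xy : 0 < x + y.
  by rewrite letters_in_count ?letters_in_take // size_takel.
have cb : (c - U_(k) <= b)%MM.
  by apply: lepm_trans (lem_subr _ _) _; apply: lem_subr.
have ltk : (c - U_(k))%MM k < b k by rewrite mnmBE mnm1E eqxx -ck; lia.
apply/negP; have [x0|x0] := posnP x.
  by apply: (no_lower jk cb _ ltk); rewrite mnmBE cj; lia.
by apply: (no_lower ik cb _ ltk); rewrite mnmBE ci; lia.
Qed.

Lemma card_point_vertices : 0 < r <= size w ->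
  #|faces 1 (koszul I c)| = inside x.+1 y + inside x y.+1.
Proof.
move=> rw; rewrite -point_i -point_j.
have s12 : ([set i] == [set j]) = false by rewrite (inj_eq set1_inj) (negPf ij).
transitivity #|[set t in [:: [set i]; [set j]] | t \in koszul I c]|.
  apply: eq_card => t; rewrite !inE andbC -in_koszul; apply/andP/andP.
    case=> /cards1P[v ->] vK; split=> //.
    case/or3P: (ijk_cover ijk_uniq v) vK => /eqP->; rewrite ?eqxx ?orbT //.
    by rewrite (negPf (point_k rw)).
  by case=> /orP[] /eqP-> ->; rewrite cards1.
rewrite -sum1_card big_mkcond /= -[RHS]addn0.
rewrite (bigD1 [set i]) //= (bigD1 [set j]) 1?eq_sym ?s12 //= big1 ?addn0.
  by rewrite !inE !eqxx orbT -!in_koszul; do 2!case: (_ \in _).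
by move=> t /andP[/negPf ti /negPf tj]; rewrite !inE ti tj.
Qed.

End Point.

Lemma live_word_nil : alive [::].
Proof.
have xb : count_mem i (take 0 ([::] : seq 'I_3)) <= b i by [].
have yb : count_mem j (take 0 ([::] : seq 'I_3)) <= b j by [].
have b0 : path_degree b [::] 0 = b by apply/mnmP=> v; rewrite mnmBE mnmE subn0.
have tn : ij_word [::] by [].
rewrite /live_word /live -[X in inside X.+1 _]/(count_mem i (take 0 [::])).
by rewrite -(point_i tn xb yb) -(point_j tn xb yb) b0 !koszul_vertex.
Qed.

Lemma few_vertices w r : ij_word w -> r <= size w ->
    count_mem i (take r w) <= b i -> count_mem j (take r w) <= b j ->
  (#|faces 1 (koszul I (path_degree b w r))| <= 1) = ~~ alive (take r w).
Proof.
(* The start is treated apart: at [b] the vertex [k] is present and [card_point_vertices] does not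
   apply, but [i] and [j] already give two vertices. *)
move=> tw rw xb yb; case: (posnP r) => [->|r0].
  rewrite take0 live_word_nil; apply/negP=> card1.
  have b0 : path_degree b w 0 = b.
    by apply/mnmP=> v; rewrite mnmBE mnmE take0 subn0.
  have : [set [set i]; [set j]] \subset faces 1 (koszul I b).
    apply/subsetP=> t; rewrite !inE => /orP[] /eqP ->; rewrite cards1 andbT.
      by rewrite -in_koszul koszul_vertex.
    by rewrite -in_koszul koszul_vertex.
  move/subset_leq_card; rewrite cards2 (inj_eq set1_inj) ij.
  rewrite -[X in faces 1 (koszul I X)]b0.
  by move/leq_trans/(_ card1).
rewrite (card_point_vertices tw xb yb) ?r0 // /live_word /live.
by do 2!case: (inside _ _).
Qed.

Lemma is_pathE p w : p < s -> is_path (gen p) b w = leads_to p w.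
Proof.
move=> ps; have [_ _ gk] := genP ps.
have := gen_le i ps; have := gen_le j ps; rewrite /path_to /gen_dist => gj gi.
rewrite (letters_in_count_k ijk_uniq); apply/eqP/and3P=> [e | [/eqP ek /eqP ei /eqP ej]].
  have ev v : gen p v + count_mem v w = b v by rewrite -e mnmDE mnmE.
  split; apply/eqP; first by apply: (@addnI (b k)); rewrite addn0 -{1}gk ev.
    by rewrite -(ev i) addKn.
  by rewrite -(ev j) addKn.
by apply: (mnm_ijk ijk_uniq); rewrite mnmDE mnmE ?ei ?ej ?ek ?gk ?addn0 ?subnKC.
Qed.

Lemma mdeg_gen p : p < s -> mdeg (b - gen p)%MM = al p + be p.
Proof.
move=> ps; have [_ _ gk] := genP ps.
by rewrite (mdeg_ijk ijk_uniq) !mnmBE gk subnn addn0.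
Qed.

Lemma path_count_le p w r : leads_to p w ->
  count_mem i (take r w) <= b i /\ count_mem j (take r w) <= b j.
Proof.
case/and3P=> _ /eqP ei /eqP ej; split.
  by apply: leq_trans (count_takeE _ _ _) _; rewrite ei leq_subr.
by apply: leq_trans (count_takeE _ _ _) _; rewrite ej leq_subr.
Qed.

Lemma mdeg_path_stop p w : p < s -> leads_to p w ->
  mdeg (b - path_stop I b w)%MM = stop w.
Proof.
move=> ps pw; have /and3P[tw _ _] := pw.
have -> : path_stop I b w = path_degree b w (stop w).
  congr path_degree; apply: eq_in_find => r; rewrite mem_iota ltnS => rw.
  by have [xb yb] := path_count_le r pw; apply: few_vertices.
have [xb yb] := path_count_le (stop w) pw.
have t := letters_in_take (stop w) tw.
have sw : stop w <= size w.
  exact: (path_to_stop gen_dist_i_inc gen_dist_j_dec ps pw).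
rewrite (mdeg_ijk ijk_uniq) !mnmBE !mnmE !subKn //.
  rewrite letters_in_count // size_takel //.
  by move: t; rewrite (letters_in_count_k ijk_uniq) => /eqP->; rewrite addn0.
by move: t; rewrite (letters_in_count_k ijk_uniq) => /eqP->.
Qed.

(** Shows that the grid size is a bound [m] of the kind assumed in the staircase argument. *)
Lemma stop_le_grid_size p w : p < s -> leads_to p w -> stop w <= grid_size I gens b.
Proof.
move=> ps pw; rewrite -(mdeg_path_stop ps pw) /grid_size.
have sw : size w == mdeg (b - gen p)%MM.
  case/and3P: pw => tw /eqP ei /eqP ej.
  by rewrite mdeg_gen // -(letters_in_count ij tw) ei ej.
apply: leq_trans (leq_bigmax_seq _ (mem_nth 0%MM ps) isT).
apply: (bigmax_sup (Tuple sw)) => //.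
by rewrite is_pathE.
Qed.

(** * Hedgerows and fences *)

Section Sylvan.

Local Open Scope ring_scope.

Variable leT : rel 'I_3.
Hypotheses (leT_total : total leT) (leT_anti : antisymmetric leT).

(** By monotonicity the lcm takes its [i] exponent from generator [q] and its [j] exponent from
    [q.+1], so it is the corner [(al q, be q.+1)]. *)
Lemma takes_side_gens q w : (q.+1 < s)%N -> ij_word w ->
    (al q + be q.+1 < size w)%N ->
  (takes_side b (mlcm (gen q) (gen q.+1)) j w = side_j j al be q w) *
  (takes_side b (mlcm (gen q) (gen q.+1)) i w = side_i i al be q w).
Proof.
move=> qs tw sw; set sg := mlcm _ _.
have qq : (q < q.+1 < s)%N by rewrite ltnSn.
have [_ g1b g1k] := genP (ltnW qs).
have [_ g2b g2k] := genP qs.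
have sgb : (sg <= b)%MM by rewrite lem_mlcm g1b.
have sgi : sg i = gen q i.
  by rewrite mnmE (maxn_idPl _) // ltnW // gen_i_gt.
have sgj : sg j = gen q.+1 j.
  by rewrite mnmE (maxn_idPr _) // ltnW // gen_j_lt.
have sgk : sg k = b k by rewrite mnmE g1k g2k maxnn.
split.
  by rewrite (takes_sideE ijk_uniq sgb sgk tw) sgi sgj.
have jik : uniq [:: j; i; k].
  by rewrite /= !inE negb_or [j == i]eq_sym ij ik jk.
have tw' : letters_in j i w.
  by rewrite (letters_in_count_k jik) -(letters_in_count_k ijk_uniq).
by rewrite (takes_sideE jik sgb sgk tw') sgi sgj addnC.
Qed.

Lemma nb_grid_pathsE l m : (l < s)%N ->
    (forall p w, (p < s)%N -> leads_to p w -> (stop w <= m)%N) ->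
  nb_grid_paths gens b i j m l =
    #|[set w : m.-tuple 'I_3 | between i j s al be l w]|.
Proof.
move=> ls stop_m; apply: eq_card => w; rewrite !inE /between.
rewrite -/(ij_word w); case: (boolP (ij_word w)) => //= tw.
have corner := corner_size gen_dist_i_inc gen_dist_j_dec ij stop_m.
congr (_ && _).
  case: l ls => // q qs; rewrite /= mlcmC.
  by rewrite takes_side_gens ?size_tuple ?corner.
case: ltnP => //= l1.
by rewrite takes_side_gens ?size_tuple ?corner.
Qed.

(** * Hedgerows and fences along one path to a generator *)

Section Path.

Variables (p : nat) (w : (mdeg (b - gen p)%MM).-tuple 'I_3).
Hypotheses (ps : (p < s)%N) (pw : leads_to p w).
Local Notation n := (mdeg (b - gen p)%MM).
Local Notation K r := (koszul I (path_degree b w r)).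
Local Notation wi r := (nth ord0 w r).

Let tw : ij_word w. Proof. by case/and3P: pw. Qed.
Let xb r : (count_mem i (take r w) <= b i)%N.
Proof. by case: (path_count_le r pw). Qed.
Let yb r : (count_mem j (take r w) <= b j)%N.
Proof. by case: (path_count_le r pw). Qed.
Let xp r : (count_mem i (take r w) <= al p)%N.
Proof. by case/and3P: pw => _ /eqP <- _; apply: count_takeE. Qed.
Let yp r : (count_mem j (take r w) <= be p)%N.
Proof. by case/and3P: pw => _ _ /eqP <-; apply: count_takeE. Qed.

Lemma path_point_set0 r : set0 \in K r.
Proof.
rewrite (point_set0 tw (xb r) (yb r)).
by apply/insideP; exists p.
Qed.

Lemma path_letter r : (r < n)%N -> (wi r == i) || (wi r == j).
Proof.
move=> rn; have : wi r \in (w : seq _) by rewrite mem_nth ?size_tuple.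
by move/(allP tw); rewrite !inE.
Qed.

(** The degree after the step is still above the target generator, hence in the ideal. *)
Lemma path_step_vertex r : (r < n)%N -> [set wi r] \in K r.
Proof.
move=> rn; have := xp r.+1; have := yp r.+1.
rewrite (take_nth ord0) ?size_tuple // -cats1 !count_cat /=.
case/orP: (path_letter rn) => /eqP->.
  rewrite eqxx (negPf ij) !addn0 addn1 => jp ip.
  rewrite (point_i tw (xb r) (yb r)).
  by apply/insideP; exists p.
rewrite eqxx [j == i]eq_sym (negPf ij) !addn0 addn1 => jp ip.
rewrite (point_j tw (xb r) (yb r)).
by apply/insideP; exists p.
Qed.

Let stop_gt0 : (0 < stop w)%N.
Proof.
apply: stop_gt; rewrite ?take0 //.
exact: live_word_nil.
Qed.

Let stop_le_n : (stop w <= n)%N.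
Proof.
rewrite -[X in (_ <= X)%N](size_tuple w).
exact: (path_to_stop gen_dist_i_inc gen_dist_j_dec ps pw).
Qed.

(** Hedges correspond to vertices: both [i] and [j] before the stop, and afterwards only the next
    letter of the path. The predecessor of [stop w] appears because [r] indexes the degree after
    [r.+1] steps. *)
Lemma card_path_hedges r : (r.+1 < n)%N ->
  #|[pred h | is_hedge F leT 0 (K r.+1) h]| =
    (if (r < (stop w).-1)%N then 2 else 1)%N.
Proof.
move=> rn; have Kw := path_step_vertex rn; have x := xb r.+1; have y := yb r.+1.
rewrite (card_hedges F leT (path_point_set0 _) Kw).
have r1 : (0 < r.+1 <= size w)%N by rewrite size_tuple; exact: ltnW.
rewrite (card_point_vertices tw x y r1).
case: ifPn => rs.
  have : alive (take r.+1 w).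
    by apply: stop_lt; rewrite -(prednK stop_gt0) ltnS.
  by move=> /andP[-> ->].
have : ~~ alive (take r.+1 w).
  apply: contra rs => lr; have [_ rw] := andP r1; have H := stop_gt rw lr.
  by rewrite -ltnS prednK.
rewrite /live_word /live; case/orP: (path_letter rn) Kw => /eqP->.
  by rewrite (point_i tw x y) => -> /= /negPf->.
by rewrite (point_j tw x y) => ->; rewrite andbT => /negPf->.
Qed.

Lemma stake_sets_b S :
  is_stake_set F leT 1 (koszul I b) S = (S \in [set [set [set i]]; [set [set j]]]).
Proof.
apply: is_stake_set_edge => //; try exact: koszul_vertex.
exact: faces2_b.
Qed.

(** There are two stake sets at [b], two hedges at each of the [(stop w).-1] interior degrees before
    the stop, and a single choice everywhere else. *)
Lemma nb_hedgerowsE : nb_hedgerows leT I 0 (gen p) b w = (2 ^ stop w)%N.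
Proof.
pose A := [set [set [set i]]; [set [set j]]].
pose B := [set t : n.-1.-tuple ({set {set 'I_3}} * {set {set 'I_3}}) |
  [forall r : 'I_n.-1,
     is_hedge F leT 0 (K r.+1) (nth (set0, set0) t r)]].
transitivity #|setX (setX A B) [set set0 : {set {set 'I_3}}]|.
  apply: eq_card => -[[S t] T].
  by rewrite !inE /is_hedgerow stake_sets_b is_shrubbery_size0 !inE andbA.
rewrite !cardsX cards1 muln1 cards2 (inj_eq set1_inj) (inj_eq set1_inj) ij.
rewrite (card_tuple_family (set0, set0) _
  (fun r => [pred h | is_hedge F leT 0 (K r.+1) h])).
rewrite (eq_bigr (fun r : 'I_n.-1 => if (r < (stop w).-1)%N then 2 else 1)%N).
  rewrite prod_if_const exp1n muln1 -expnS (minn_idPl _) ?prednK //.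
  by rewrite -ltnS !prednK // (leq_trans stop_gt0).
move=> r _; rewrite card_path_hedges //.
by rewrite -ltn_predRL.
Qed.

Let n_gt0 : (0 < n)%N.
Proof. exact: leq_trans stop_gt0 stop_le_n. Qed.

(* The hedge rim of i has support on the endpoint of the edge that is not a
   stake, and this has to be the first step. *)
Definition other_letter (v : 'I_3) := if v == i then j else i.

Lemma other_stake v :
  [set [set other_letter v]] \in [set [set [set i]]; [set [set j]]].
Proof. by rewrite !inE /other_letter; case: ifP => _; rewrite eqxx ?orbT. Qed.

(** Position [r] holds the hedge after [r.+1] steps; its shrubbery is the letter [wi r.+1] by which
    the path leaves that degree. *)
Definition path_hedgerow : hedgerow n :=
  ([set [set other_letter (wi 0)]],
   [tuple ([set set0], [set [set wi r.+1]]) | r < n.-1], set0).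

Definition path_taus : n.-tuple {set 'I_3} := [tuple [set wi r] | r < n].

Definition path_sigs : n.-tuple {set 'I_3} := [tuple set0 | r < n].

Lemma path_tausE r : (r < n)%N -> nth set0 path_taus r = [set wi r].
Proof. by move=> rn; rewrite -[r]/(nat_of_ord (Ordinal rn)) nth_mktuple. Qed.

Lemma path_sigsE r : (r < n)%N -> nth set0 path_sigs r = set0.
Proof. by move=> rn; rewrite -[r]/(nat_of_ord (Ordinal rn)) nth_mktuple. Qed.

Lemma path_hedgeE r : (r < n.-1)%N ->
  hedge_at path_hedgerow r.+1 = ([set set0], [set [set wi r.+1]]).
Proof.
by move=> rn; rewrite /hedge_at -[r.+1.-1]/(nat_of_ord (Ordinal rn)) nth_mktuple.
Qed.

Let pred_n r : (r < n.-1)%N = (r.+1 < n)%N.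
Proof. by rewrite -ltnS prednK. Qed.

Lemma hedge_rim_first S : S \in [set [set [set i]]; [set [set j]]] ->
  hedge_rim F leT 1 (koszul I b) S [set i] [set wi 0] =
    (S == [set [set other_letter (wi 0)]])%:R.
Proof.
have ji : (j == i) = false by rewrite eq_sym (negPf ij).
have [Ki Kj] := (koszul_vertex i, koszul_vertex j).
have K2 := faces2_b.
rewrite !inE => /orP[] /eqP->; rewrite (inj_eq set1_inj) (inj_eq set1_inj).
  rewrite (hedge_rim_edge' F leT_total leT_anti ij Kj K2).
  rewrite face_chainE (inj_eq set1_inj) /other_letter.
  by case/orP: (path_letter n_gt0) => /eqP->; rewrite ?eqxx ?ji ?(negPf ij) ?eqxx.
rewrite (hedge_rim_edge F leT_total leT_anti ij Ki K2).
rewrite face_chainE (inj_eq set1_inj) /other_letter.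
by case/orP: (path_letter n_gt0) => /eqP->; rewrite ?eqxx ?ji ?(negPf ij) ?eqxx.
Qed.

Lemma is_fenceE H taus sigs :
  is_fence leT I 0 (gen p) b [set i] set0 w H taus sigs =
    [&& H == path_hedgerow, taus == path_taus & sigs == path_sigs].
Proof.
apply/idP/and3P=> [| [/eqP-> /eqP-> /eqP->]]; last first.
  rewrite /is_fence; apply/and5P; split; last (apply/and3P; split).
  - apply/and3P; split.
    + by rewrite stake_sets_b other_stake.
    + apply/forallP=> r; rewrite path_hedgeE //.
      have rn : (r.+1 < n)%N by rewrite -pred_n.
      have Kv := path_step_vertex rn.
      rewrite (is_hedge_vertex F leT _ (path_point_set0 _) Kv) /= eqxx cards1.
      by rewrite sub1set set1_faces.
    + by rewrite is_shrubbery_size0.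
  - apply/forallP=> r; rewrite path_tausE // set1_faces //.
    exact: path_step_vertex.
  - apply/forallP=> r; rewrite (path_sigsE (ltn_ord r)) inE cards0 eqxx andbT.
    exact: path_point_set0.
  - rewrite path_tausE // hedge_rim_first ?eqxx ?oner_neq0 //.
    exact: other_stake.
  - apply/forallP=> r.
    rewrite (path_tausE (ltn_ord r)) (path_sigsE (ltn_ord r)) inE eqxx /=.
    by rewrite setDv.
  - apply/forallP=> r; have rn : (r.+1 < n)%N by rewrite -pred_n.
    rewrite path_hedgeE // (path_sigsE (ltnW rn)) inE eqxx (path_tausE rn).
    by rewrite shrub_size1 face_chainE eqxx oner_neq0.
  - by rewrite path_sigsE ?prednK // circuit_set0 face_chainE eqxx oner_neq0.
case/and5P=> hr /forallP tausK _ rim /and3P[/forallP steps /forallP links _].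
(* Each tau is a single vertex and contains the letter of its step. *)
have tausE r : (r < n)%N -> nth set0 taus r = [set wi r].
  move=> rn; have := tausK (Ordinal rn); rewrite inE => /andP[_ /cards1P[v tv]].
  by have /andP[] := steps (Ordinal rn); rewrite /= tv inE => /eqP->.
have sigsE r : (r < n)%N -> nth set0 sigs r = set0.
  move=> rn; have /andP[_ /eqP] := steps (Ordinal rn).
  by rewrite /= tausE // setDv.
split; last first.
- apply/eqP/eq_from_tnth=> r; rewrite !(tnth_nth set0) path_sigsE // sigsE //.
- apply/eqP/eq_from_tnth=> r; rewrite !(tnth_nth set0) path_tausE // tausE //.
case: H hr rim links {tausK steps} => [[S t] T] /and3P[].
rewrite stake_sets_b is_shrubbery_size0 => SK /forallP hs /eqP TE.
rewrite tausE // hedge_rim_first // => rim links.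
(* The rim coefficient on the first letter is nonzero only for this stake. *)
have SE : S = [set [set other_letter (wi 0)]].
  by apply/eqP; move: rim; case: (S == _); rewrite ?eqxx.
(* The shrub of the empty face is the chosen vertex, so the chain-link to the next tau identifies
   the shrubbery. *)
have tE : t = [tuple ([set set0], [set [set wi r.+1]]) | r < n.-1].
  apply: eq_from_tnth => r; rewrite tnth_mktuple (tnth_nth (set0, set0)).
  have rn : (r.+1 < n)%N by rewrite -pred_n.
  have := hs r; have := links r; rewrite /hedge_at /=.
  rewrite sigsE ?(ltnW rn) // tausE //.
  case: (nth _ t r) => [S' T'] /= /andP[_ link].
  rewrite (is_hedge_vertex F leT _ (path_point_set0 _) (path_step_vertex rn)) /=.
  case/and3P=> /eqP SE' T'K /cards1P[u T'E]; move: T'K link; rewrite SE' T'E.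
  rewrite sub1set inE => /andP[_ /cards1P[v ->]].
  rewrite shrub_size1 face_chainE.
  by case: (eqVneq [set wi r.+1] [set v]) => [->|_]; rewrite ?eqxx.
by move: TE => /= ->; rewrite SE tE.
Qed.

Lemma path_fence_weight :
  fence_weight leT I 0 b [set i] set0 path_hedgerow path_taus path_sigs = 1.
Proof.
rewrite /fence_weight path_tausE // hedge_rim_first; last first.
  exact: other_stake.
rewrite eqxx mul1r path_sigsE ?prednK // circuit_set0 face_chainE eqxx mulr1.
rewrite big_nat_cond big1 ?mul1r => [|[//|r] /andP[/andP[_ rn] _]].
  rewrite big_nat_cond big1 // => -[//|r] /andP[/andP[_ rn] _] /=.
  by rewrite path_tausE // path_sigsE // face_boundary1 face_chainE eqxx.
rewrite path_hedgeE ?pred_n // path_sigsE ?(ltnW rn) // path_tausE //.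
by rewrite shrub_size1 face_chainE eqxx.
Qed.

Lemma sum_fence_weights :
  \sum_(H : hedgerow n) \sum_(taus : n.-tuple {set 'I_3})
    \sum_(sigs : n.-tuple {set 'I_3} |
          is_fence leT I 0 (gen p) b [set i] set0 w H taus sigs)
      fence_weight leT I 0 b [set i] set0 H taus sigs = 1.
Proof.
rewrite (bigD1 path_hedgerow) //= [X in _ + X]big1 => [|H /negPf nH]; last first.
  by rewrite big1 // => taus _; rewrite big_pred0 // => sigs; rewrite is_fenceE nH.
rewrite addr0 (bigD1 path_taus) //= [X in _ + X]big1 => [|taus /negPf nt].
  rewrite addr0 (big_pred1 path_sigs) ?path_fence_weight // => sigs.
  by rewrite is_fenceE !eqxx.
by rewrite big_pred0 // => sigs; rewrite is_fenceE nt andbF.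
Qed.

End Path.

Lemma sylvan_entry_count (m l : nat) : (l < s)%N -> 2%:R != 0 :> F ->
    (forall p w, (p < s)%N -> leads_to p w -> (stop w <= m)%N) ->
  sylvan_entry leT I 0 (gen l) b set0 [set i] =
    (nb_grid_paths gens b i j m l)%:R / 2%:R ^+ m.
Proof.
move=> ls F2 stop_m; rewrite /sylvan_entry nb_grid_pathsE //.
rewrite -(card_between gen_dist_i_inc gen_dist_j_dec ij stop_m ls (mdeg_gen ls)).
rewrite natr_sum mulr_suml; apply: eq_big => [w | w]; first exact: is_pathE.
rewrite is_pathE // => pw; rewrite (nb_hedgerowsE ls pw) (sum_fence_weights ls pw).
have sm := stop_m l w ls pw.
(* Each path contributes 2^-stop, rewritten as 2^(m - stop) / 2^m using that 2 is invertible. *)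
by rewrite mulr1 -{2}(subnKC sm) !natrX exprD invfM mulrCA divff ?mulr1 ?expf_neq0.
Qed.

End Sylvan.

End Slice.

Theorem corollary3p6 (F : fieldType) (hF2 : 2%N \notin [pchar F])
    (hF3 : 3%N \notin [pchar F])
    (leT : rel 'I_3) (leT_total : total leT) (leT_anti : antisymmetric leT)
    (leT_trans : transitive leT)
    (i j k : 'I_3) (ijk_uniq : uniq [:: i; j; k])
    (I : {pred {mpoly F[3]}}) (I_mon : monomial_ideal I)
    (b : 'X_{1..3})
    (Kb : facets (koszul I b) = [set [set i; j]; [set k]])
    (gens : seq 'X_{1..3})
    (gensP : forall u : 'X_{1..3},
       u \in gens <-> min_generator I u /\ lies_behind i j u b)
    (gens_sorted : sorted (fun u v : 'X_{1..3} => (u j < v j)%N) gens)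
    (l : nat) (hl : (l < size gens)%N) :
  let m := grid_size I gens b in
  sylvan_entry leT I 0 (nth 0%MM gens l) b set0 [set i] =
    (nb_grid_paths gens b i j m l)%:R / 2%:R ^+ m.
Proof.
(* [hF2] reduces to this because [prime 2] computes to [true]. *)
move=> m; have F2 : 2%:R != 0 :> F by [].
apply: (sylvan_entry_count I_mon ijk_uniq Kb gensP gens_sorted) => //.
by move=> p w; apply: (stop_le_grid_size I_mon ijk_uniq Kb gensP gens_sorted).
Qed.
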